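(* Let $p_1,p_2,\dots$ be independent random variables with common distribution $Q$, a probability measure on $[0,1]$, let $\Pi=\Pi(Q)\in[0,\infty]$ be as defined in the context, and let $P_{r,K}$ denote $P_{r,K}(p_1,\dots,p_K)$. If $\Pi>1$ (possibly $\Pi=\infty$, with $1/\Pi:=0$), then: (i) if $r>-1$, then $P_{r,K}\to(r+1)^{1/r}\,\mathbb{E}(p_1^r)^{1/r}\in(0,\infty)$ a.s. as $K\to\infty$; (ii) if $-\Pi<r<-1$, then $P_{r,K}\sim\frac{r}{r+1}K^{1+1/r}\,\mathbb{E}(p_1^r)^{1/r}\to\infty$ a.s. as $K\to\infty$; (iii) if $-\infty<r<-\Pi$, then $P_{r,K}\approx K^{1-1/\Pi}$ (where $K^{1-1/\Pi}\to\infty$); (iv) if $r=-\infty$, then $\lim_{K\to\infty}P_{r,K}/K^b=\infty$ in probability for every $b<1-1/\Pi$. If $\Pi\in(0,1)$, then: (i) if $r>-\Pi$, then $P_{r,K}\to(r+1)^{1/r}\,\mathbb{E}(p_1^r)^{1/r}\in(0,\infty)$ a.s. as $K\to\infty$; (ii) if $-1<r<-\Pi$, then $P_{r,K}\approx K^{-1/r-1/\Pi}$ (where $K^{-1/r-1/\Pi}\to0$); (iii) if $-\infty<r<-1$, then $P_{r,K}\approx K^{1-1/\Pi}$ (where $K^{1-1/\Pi}\to0$); (iv) if $r=-\infty$, then $\liminf_{K\to\infty}P_{r,K}/K^b=0$ a.s. for every $b>1-1/\Pi$.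
   Context: $\Pi(Q):=\sup\{m\in[0,\infty)\mid\mathbb{E}(p_1^{-m})=\int p^{-m}\,Q(dp)<\infty\}\in[0,\infty]$. $P_{r,K}(p_1,\dots,p_K):=a_{r,K}M_{r,K}(p_1,\dots,p_K)$ for $r\in[-\infty,\infty]$, where $M_{r,K}(p_1,\dots,p_K):=\left(\frac{p_1^r+\dots+p_K^r}{K}\right)^{1/r}$ for $r\in\mathbb{R}\setminus\{0\}$, $M_{0,K}:=\left(\prod_{k=1}^Kp_k\right)^{1/K}$, $M_{\infty,K}:=\max_kp_k$, $M_{-\infty,K}:=\min_kp_k$, and $a_{r,K}:=(r+1)^{1/r}$ if $r\in(-1,\infty]$ (equal to $e$ if $r=0$ and $1$ if $r=\infty$), $a_{r,K}:=e\ln K$ if $r=-1$, and $a_{r,K}:=\frac{r}{r+1}K^{1+1/r}$ if $r\in[-\infty,-1)$ (equal to $K$ if $r=-\infty$). The expression $\mathbb{E}(p_1^r)^{1/r}$ means $(\mathbb{E}(p_1^r))^{1/r}$ and is understood as its limiting value $\exp(\mathbb{E}\ln p_1)$ for $r=0$ and as the essential supremum of $p_1$ for $r=\infty$. For $a\in\mathbb{R}$, $P_{r,K}\approx K^a$ means: almost surely, $\liminf_{K\to\infty}P_{r,K}/K^b=0$ for $b>a$ and $\lim_{K\to\infty}P_{r,K}/K^b=\infty$ for $b<a$. For sequences, $b_K\sim c_K$ means $b_K/c_K\to1$. *)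

(* Defs.v *)
From HB Require Import structures.
From mathcomp Require Import all_boot all_order all_algebra.
From mathcomp Require Import all_classical all_reals all_analysis.
From mathcomp Require Import ess_sup_inf.

Set Implicit Arguments.
Unset Strict Implicit.
Unset Printing Implicit Defensive.

Import Order.TTheory GRing.Theory Num.Theory.
Import numFieldNormedType.Exports.

Local Open Scope classical_set_scope.
Local Open Scope ring_scope.

Section averaging.
Context {R : realType}.

(* Real powers on [0, +oo] with 0^s = +oo and (+oo)^s = 0 for s < 0; the
   library's poweR instead gives 0 `^ s = 0 and +oo `^ s = +oo for s < 0. *)
Definition epow (x : \bar R) (s : R) : \bar R :=
  if s < 0 then ((x `^ (- s))^-1)%E else (x `^ s)%E.

(* M_{r,K}(x_0, ..., x_(K-1)) for K >= 1; only the first K terms of the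
   sequence x matter (x 0 is also the base value of the iterated max and min).
   If r < 0 and some x_k = 0, the conventions of epow make the mean 0. *)
Definition power_mean (r : \bar R) (K : nat) (x : nat -> R) : R :=
  match r with
  | s%:E => if s == 0 then (\prod_(k < K) x k) `^ (K%:R^-1)
            else fine (epow ((\sum_(k < K) epow (x k)%:E s) * (K%:R^-1)%:E)%E
                            s^-1)
  | +oo%E => \big[Num.max/x 0]_(k < K) x k
  | -oo%E => \big[Num.min/x 0]_(k < K) x k
  end.

(* (r + 1)^(1/r) for r in (-1, +oo], extended by continuity at 0 and +oo;
   the values for r <= -1 are never used. *)
Definition succ_root (r : \bar R) : R :=
  match r with
  | s%:E => if s == 0 then expR 1 else (s + 1) `^ s^-1
  | _ => 1
  end.

(* The constants a_{r,K} turning averages M_{r,K} of p-values into p-values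
   a_{r,K} M_{r,K}; only r <= -1 depends on K. *)
Definition avg_coef (r : \bar R) (K : nat) : R :=
  match r with
  | s%:E => if -1 < s then succ_root s%:E
            else if s == -1 then expR 1 * ln K%:R
            else s / (s + 1) * K%:R `^ (1 + s^-1)
  | +oo%E => succ_root +oo%E
  | -oo%E => K%:R
  end.

Definition merged (r : \bar R) (K : nat) (x : nat -> R) : R :=
  avg_coef r K * power_mean r K x.

(* Pi(Q); the integrand is +oo at x = 0 when m > 0. *)
Definition moment_index (Q : probability R R) : \bar R :=
  ereal_sup [set m%:E | m in
    [set m : R | 0 <= m /\ (\int[Q]_x epow x%:E (- m) < +oo)%E]].

(* E(p^r)^(1/r) for p distributed as Q, with its limiting values at 0, +oo
   and -oo. *)
Definition moment_root (Q : probability R R) (r : \bar R) : \bar R :=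
  match r with
  | s%:E => if s == 0 then expeR (\int[Q]_x lne x%:E)%E
            else epow (\int[Q]_x epow x%:E s)%E s^-1
  | +oo%E => ess_sup Q (fun x : R => x%:E)
  | -oo%E => ess_inf Q (fun x : R => x%:E)
  end.

End averaging.

Section random_sequences.
Context {d : measure_display} {T : measurableType d} {R : realType}.
Variable Pr : probability T R.

Definition mutually_independent (X : nat -> {RV Pr >-> R}) : Prop :=
  forall (J : seq nat) (A : nat -> set R),
    uniq J -> (forall k, measurable (A k)) ->
    Pr (\bigcap_(k in [set` J]) (X k @^-1` A k)) =
    (\prod_(k <- J) Pr (X k @^-1` A k))%E.

(* u_K is of order K^a up to sub-polynomial factors, with the upper bound only
   along a subsequence; the exceptional null set is the same for all b. *)
Definition approx_pow (u : nat -> T -> R) (a : R) : Prop :=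
  {ae Pr, forall w,
    (forall b : R, a < b -> limn_einf (fun K => (u K w / K%:R `^ b)%:E) = 0%E)
    /\ (forall b : R, b < a -> u K w / K%:R `^ b @[K --> \oo] --> +oo)}.

Definition cvg_infty_in_probability (u : nat -> T -> R) : Prop :=
  forall M : R, Pr [set w | M < u K w] @[K --> \oo] --> 1%E.

End random_sequences.

(* Main.v *)
Require Import Defs.
From HB Require Import structures.
From mathcomp Require Import all_boot all_order all_algebra.
From mathcomp Require Import all_classical all_reals all_analysis.
From mathcomp Require Import measurable_realfun ess_sup_inf ring lra.

Set Implicit Arguments.
Unset Strict Implicit.
Unset Printing Implicit Defensive.

Import Order.TTheory GRing.Theory Num.Theory.
Import numFieldNormedType.Exports.

Local Open Scope classical_set_scope.
Local Open Scope ring_scope.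

(** Write S_K(r) for the sum of the powers p_k ^ r over k < K. Up to an explicit
    constant, P_{r,K} is a power of K times S_K(r) ^ (1/r), so everything
    depends on how S_K(r) grows.

    If - Pi < r, then p ^ r still has a finite moment of some order above 1,
    because the inequality is strict. The strong law of large numbers
    ([strong_law_of_large_numbers]) gives S_K(r) / K --> E(p ^ r), and
    continuity of the power function yields the limits of [ae_cvg_merged] and
    the equivalent of [ae_merged_equiv]. For r = 0 the same law is applied to
    - ln p. For r = +oo the running maximum tends to the essential supremum.

    If r < - Pi, the moment is infinite and S_K(r) ^ (1/r) is squeezed.
    - From below: the norms of l^s decrease in s, hence
      S_K(r) ^ (1/r) >= S_K(-m) ^ (-1/m) for every m < Pi, and S_K(-m) is at
      most linear in K by the strong law ([ae_power_sum_bound]). This gives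
      the order K ^ (-1/m).
    - From above: a sum of positive terms exceeds each of them, hence
      S_K(r) ^ (1/r) <= p_k for every k < K. For m > Pi the moment
      E(p ^ (-m)) is infinite, so the probabilities of p_k ^ (-m) >= k + 1
      have a divergent sum, and the second Borel-Cantelli lemma produces
      infinitely many k with p_k <= (k + 1) ^ (-1/m) ([ae_small_pvalues]).
    Letting m tend to Pi from both sides identifies the order K ^ (-1/Pi)
    ([approx_pow_power_sum]). The minimum, which is the case r = -oo, obeys
    the same two bounds.

    The strong law is proved for a nonnegative function with a finite moment
    of order 1 + e. Along K_n = (n + 1) ^ q with q e >= 2, truncation at level
    K_n leaves a sample mean whose variance is O(n ^ (-2)) and a remainder
    whose expectation is O(n ^ (-2)); both errors are summable, hence vanish
    almost surely. Between K_n and K_(n+1) the partial sums are monotone and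
    K_(n+1) / K_n tends to 1. *)

(** * Summable integrals *)

Section summable_integrals.
Context {d : measure_display} {T : measurableType d} {R : realType}.
Variable mu : {measure set T -> \bar R}.

Lemma nneseries_inv_sqr_lty (C : R) : 0 <= C ->
  (\sum_(n <oo) (C / n.+1%:R ^+ 2)%:E < +oo)%E.
Proof.
move=> C0; apply: (@le_lt_trans _ _ (C * 2)%:E); last by rewrite ltry.
apply: lime_le.
  by apply: is_cvg_nneseries => n _ _; rewrite lee_fin divr_ge0 ?exprn_ge0.
apply: nearW => N; rewrite sumEFin lee_fin -mulr_sumr ler_wpM2l//.
rewrite big_mkord.
suff H n : \sum_(i < n.+1) i.+1%:R ^- 2 <= 2 - n.+1%:R^-1 :> R.
  case: N => [|N]; first by rewrite big_ord0.
  by rewrite (le_trans (H N))// gerBl invr_ge0.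
elim: n => [|n IH].
  by rewrite big_ord_recr big_ord0 /= add0r expr1n invr1; lra.
rewrite big_ord_recr/= (le_trans (lerD IH (lexx _)))//.
rewrite -addrA lerD2l -subr_ge0.
have -> : n.+2%:R = n.+1%:R + 1 :> R by rewrite -natr1.
have N0 : (0 : R) < n.+1%:R by rewrite ltr0n.
set x : R := n.+1%:R in N0 *.
rewrite [leRHS](_ : _ = (x * (x + 1) ^+ 2)^-1).
  by rewrite invr_ge0 mulr_ge0 ?exprn_ge0 ?addr_ge0// ltW.
by field; rewrite !gt_eqF// addr_gt0.
Qed.

(** The series of the h n has a finite integral, so it converges almost
    everywhere and its terms vanish. This replaces a tail estimate followed by
    the first Borel-Cantelli lemma. *)
Lemma summable_integral_ae_cvg0 (h : nat -> T -> R) :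
  (forall n, measurable_fun setT (h n)) -> (forall n x, 0 <= h n x) ->
  (\sum_(n <oo) \int[mu]_x (h n x)%:E < +oo)%E ->
  {ae mu, forall x, h n x @[n --> \oo] --> (0 : R)}.
Proof.
move=> mh h0 hoo.
pose S x : \bar R := (\sum_(n <oo) (h n x)%:E)%E.
have m1 : measurable_fun [set: T] S.
  by apply: ge0_emeasurable_sum => // [k x _ _|k _];
    [rewrite lee_fin|exact/measurable_EFinP].
have ii : mu.-integrable [set: T] S.
  apply/integrableP; split => //.
  under eq_integral => x _.
    rewrite gee0_abs; last by apply: nneseries_ge0 => n _ _; rewrite lee_fin.
    over.
  rewrite integral_nneseries//; first by move=> n; exact/measurable_EFinP.
  by move=> n x _; rewrite lee_fin.
have := integrable_ae measurableT ii.
apply: filterS => x /(_ I) xfin.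
have xlt : (\sum_(n <oo) (h n x)%:E < +oo)%E.
  by rewrite ltey_eq xfin.
have tl := nneseries_tail_cvg xlt (fun k _ => h0 k x).
suff /fine_cvgP[_ //] : (h n x)%:E @[n --> \oo] --> 0%E.
apply: (squeeze_cvge _ (cvg_cst 0%E) tl).
apply: nearW => n; rewrite lee_fin h0/=.
have := @nneseries_lim_ge _ (fun n => (h n x)%:E) xpredT n n.+1.
rewrite big_nat1; apply => k _ _; rewrite lee_fin//.
Qed.
End summable_integrals.

(** * Moments of independent identically distributed variables *)

Section iid.
Context {d : measure_display} {T : measurableType d} {R : realType}.
Context {Pr : probability T R} {Q : probability R R}.
Context {p : nat -> {RV Pr >-> R}}.
Hypothesis hdist : forall (k : nat) (A : set R),
  measurable A -> distribution Pr (p k) A = Q A.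
Hypothesis hindep : mutually_independent p.

Lemma ge0_expectation_comp k (f : R -> \bar R) :
  measurable_fun setT f -> (forall x, 0 <= f x)%E ->
  (\int[Pr]_w f (p k w) = \int[Q]_x f x)%E.
Proof.
move=> mf f0; rewrite -(ge0_integral_distribution (p k) mf f0).
by apply: eq_measure_integral => A mA _; exact: hdist.
Qed.

(** The product rule on events says that (p_i, p_j) is distributed according to
    the product measure, and Tonelli's theorem splits the integral. *)
Lemma ge0_expectation_mul i j (f g : R -> \bar R) : i != j ->
  measurable_fun setT f -> (forall x, 0 <= f x)%E ->
  measurable_fun setT g -> (forall x, 0 <= g x)%E ->
  (\int[Pr]_w (f (p i w) * g (p j w)) =
   (\int[Q]_x f x) * (\int[Q]_x g x))%E.
Proof.
move=> ij mf f0 mg g0.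
have mX : measurable_fun setT (fun w => (p i w, p j w)).
  exact: measurable_fun_pair.
pose X : {mfun T >-> _} := HB.pack (fun w => (p i w, p j w))
  (isMeasurableFun.Build _ _ _ _ (fun w => (p i w, p j w)) mX).
have mfg : measurable_fun setT (fun z : R * R => f z.1 * g z.2)%E.
  by apply: emeasurable_funM; apply: measurableT_comp.
have fg0 (z : R * R) : (0 <= f z.1 * g z.2)%E by rewrite mule_ge0.
rewrite -(ge0_integral_distribution X mfg fg0).
transitivity (\int[Q \x Q]_z (f z.1 * g z.2))%E.
  apply: eq_measure_integral => A mA _.
  apply/esym/product_measure_unique => // B C mB mC.
  transitivity (distribution Pr (p i) B * distribution Pr (p j) C)%E;
    last first.
    by rewrite !hdist.
  have := @hindep [:: i; j] (fun k => if k == i then B else C).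
  rewrite /= inE ij => /(_ isT).
  rewrite !big_cons big_nil mule1 eqxx eq_sym (negbTE ij) => <-.
  - congr (Pr _); apply/seteqP; split => [w /= [Bw Cw] k /=|w /= H].
      rewrite !inE => /orP[]/eqP ->; rewrite ?eqxx//.
      by rewrite eq_sym (negbTE ij).
    have := H i; have := H j.
    rewrite /= !inE !eqxx orbT eq_sym (negbTE ij) => Cw Bw.
    by split; [exact: Bw|exact: Cw].
  - by move=> k; case: ifP.
rewrite fubini_tonelli1//.
under eq_integral => x _.
  rewrite /fubini_F/= ge0_integralZl//.
  over.
by rewrite ge0_integralZr// ?integral_ge0.
Qed.


(** The variance of a sum of pairwise uncorrelated terms is at most the sum of
    the second moments. Expanding (S - K mu)^2 + 2 K mu S = S^2 + (K mu)^2,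
    whose terms are all nonnegative, keeps every integral in the realm of
    nonnegative functions. *)
Lemma second_moment_sum_le (g : R -> R) (c mu : R) K :
  measurable_fun setT g -> (forall x, 0 <= g x <= c) ->
  (\int[Q]_x (g x)%:E = mu%:E)%E ->
  (\int[Pr]_w ((\sum_(k < K) g (p k w) - K%:R * mu) ^+ 2)%:E <=
    K%:R%:E * \int[Q]_x (g x ^+ 2)%:E)%E.
Proof.
move=> mg gc muE.
have g0 x : 0 <= g x by have /andP[] := gc x.
have bnd (f : R -> R) (b : R) : measurable_fun setT f ->
    (forall x, 0 <= f x <= b) -> (\int[Q]_x (f x)%:E \is a fin_num)%E.
  move=> mf fb; rewrite ge0_fin_numE; last first.
    by apply: integral_ge0 => x _; rewrite lee_fin; case/andP: (fb x).
  apply: (@le_lt_trans _ _ (\int[Q]_x (cst b%:E x))%E).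
    apply: ge0_le_integral => //.
    - by move=> x _; rewrite lee_fin; case/andP: (fb x).
    - exact/measurable_EFinP.
    - by move=> x _; rewrite lee_fin; case/andP: (fb x).
  rewrite integral_cst// [X in (_ * X)%E](_ : _ = 1%E) ?mule1 ?ltry//.
  exact: probability_setT.
have mu0 : 0 <= mu.
  by rewrite -lee_fin -muE; apply: integral_ge0 => x _; rewrite lee_fin.
have fin2 : (\int[Q]_x (g x ^+ 2)%:E \is a fin_num)%E.
  apply: (bnd _ (c ^+ 2)); first exact: measurable_funX.
  by move=> x; case/andP: (gc x) => g0x gcx;
    rewrite sqr_ge0 lerXn2r ?nnegrE// (le_trans g0x).
pose m2 := fine (\int[Q]_x (g x ^+ 2)%:E)%E.
have m2E : (\int[Q]_x (g x ^+ 2)%:E = m2%:E)%E by rewrite fineK.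
pose S w := \sum_(k < K) g (p k w).
have mgp k : measurable_fun setT (fun w => g (p k w)) by exact:
  measurableT_comp.
have mS : measurable_fun setT S by exact: measurable_sum.
have S0 w : 0 <= S w by exact: sumr_ge0.
have Ig k : (\int[Pr]_w (g (p k w))%:E = mu%:E)%E.
  rewrite (@ge0_expectation_comp k (EFin \o g)) ?muE//.
  exact/measurable_EFinP.
have IS : (\int[Pr]_w (S w)%:E = (K%:R * mu)%:E)%E.
  under eq_integral => w _ do rewrite -sumEFin.
  rewrite ge0_integral_sum//=; first last.
  - by move=> k w _; rewrite lee_fin.
  - by move=> k; exact/measurable_EFinP.
  under eq_bigr => k _ do rewrite Ig.
  by rewrite sumEFin sumr_const card_ord mulr_natl.
have IS2 : (\int[Pr]_w (S w ^+ 2)%:E <= (K%:R * m2 + (K%:R * mu) ^+ 2)%:E)%E.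
  have -> : (\int[Pr]_w (S w ^+ 2)%:E =
      \sum_(i < K) \sum_(j < K) \int[Pr]_w (g (p i w) * g (p j w))%:E)%E.
    under eq_integral => w _.
      rewrite expr2 mulr_suml -sumEFin.
      under eq_bigr => i _ do rewrite mulr_sumr -sumEFin.
      over.
    rewrite ge0_integral_sum//=; first last.
    - by move=> i w _; rewrite sume_ge0// => j _; rewrite lee_fin mulr_ge0.
    - move=> i; apply: emeasurable_sum => j.
      by apply/measurable_EFinP; exact: measurable_funM.
    apply: eq_bigr => i _; rewrite ge0_integral_sum//; first last.
    - by move=> j w _; rewrite lee_fin mulr_ge0.
    - by move=> j; apply/measurable_EFinP; exact: measurable_funM.
  have cov (i j : 'I_K) : (\int[Pr]_w (g (p i w) * g (p j w))%:E =
      (if i == j then m2 else mu ^+ 2)%:E)%E.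
    case: eqVneq => [->|ij].
      under eq_integral => w _ do rewrite -expr2.
      rewrite (@ge0_expectation_comp j (fun x => (g x ^+ 2)%:E)) ?m2E//.
        by apply/measurable_EFinP; exact: measurable_funX.
      by move=> x; rewrite lee_fin sqr_ge0.
    under eq_integral => w _ do rewrite EFinM.
    rewrite (@ge0_expectation_mul i j (EFin \o g) (EFin \o g))//.
    - by rewrite muE -EFinM.
    - exact/measurable_EFinP.
    - exact/measurable_EFinP.
  under eq_bigr => i _ do under eq_bigr => j _ do rewrite cov.
  under eq_bigr => i _ do rewrite sumEFin.
  rewrite sumEFin lee_fin.
  have le (i j : 'I_K) : (if i == j then m2 else mu ^+ 2) <=
      (if i == j then m2 else 0) + mu ^+ 2.
    by case: ifP; rewrite ?lerDl ?sqr_ge0// add0r.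
  apply: (le_trans (ler_sum _ (fun i _ => ler_sum _ (fun j _ => le i j)))).
  rewrite (eq_bigr (fun=> m2 + K%:R * mu ^+ 2)); last first.
    move=> i _; rewrite big_split/= sumr_const card_ord mulr_natl;
      congr (_ + _).
    by rewrite -big_mkcond/= (big_pred1 i)// => j; rewrite eq_sym.
  by rewrite sumr_const card_ord -mulr_natl le_eqVlt; apply/orP; left;
    apply/eqP; ring.
have : (\int[Pr]_w ((S w - K%:R * mu) ^+ 2 + 2 * (K%:R * mu) * S w)%:E =
    \int[Pr]_w (S w ^+ 2 + (K%:R * mu) ^+ 2)%:E)%E.
  by apply: eq_integral => w _; congr (_%:E); ring.
have Kmu0 : 0 <= 2 * (K%:R * mu) by rewrite !mulr_ge0.
have mD : measurable_fun setT (fun w => (S w - K%:R * mu) ^+ 2).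
  by apply: measurable_funX; exact: measurable_funB.
have -> : (\int[Pr]_w ((S w - K%:R * mu) ^+ 2 + 2 * (K%:R * mu) * S w)%:E =
    \int[Pr]_w ((S w - K%:R * mu) ^+ 2)%:E +
    (2 * (K%:R * mu) * (K%:R * mu))%:E)%E.
  under eq_integral => w _ do rewrite EFinD [X in (_ + X)%E]EFinM.
  rewrite (ge0_integralD Pr measurableT)/=.
  - rewrite (ge0_integralZl_EFin Pr measurableT _ _ Kmu0) ?IS -?EFinM//.
    + by move=> w _; rewrite lee_fin.
    + exact/measurable_EFinP.
  - by move=> w _; rewrite lee_fin sqr_ge0.
  - exact/measurable_EFinP.
  - by move=> w _; rewrite lee_fin mulr_ge0.
  - by apply/measurable_EFinP; exact: measurable_funM.
have -> : (\int[Pr]_w (S w ^+ 2 + (K%:R * mu) ^+ 2)%:E =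
    \int[Pr]_w (S w ^+ 2)%:E + ((K%:R * mu) ^+ 2)%:E)%E.
  under eq_integral => w _ do rewrite EFinD.
  rewrite (ge0_integralD Pr measurableT)/=.
  - rewrite integral_cst// [X in (_ + _ * X)%E](_ : _ = 1%E) ?mule1//.
    exact: probability_setT.
  - by move=> w _; rewrite lee_fin sqr_ge0.
  - by apply/measurable_EFinP; exact: measurable_funX.
  - by move=> w _; rewrite lee_fin sqr_ge0.
  - exact: measurable_cst.
move=> IE; rewrite m2E -EFinM.
rewrite -(@leeD2rE _ (2 * (K%:R * mu) * (K%:R * mu))%:E)//.
rewrite IE (le_trans (leeD2r _ IS2))// -!EFinD lee_fin.
by rewrite le_eqVlt; apply/orP; left; apply/eqP; ring.
Qed.

End iid.

(** * Events that occur infinitely often *)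

Section iid_io.
Context {d : measure_display} {T : measurableType d} {R : realType}.
Context {Pr : probability T R} {Q : probability R R}.
Context {p : nat -> {RV Pr >-> R}}.
Hypothesis hdist : forall (k : nat) (A : set R),
  measurable A -> distribution Pr (p k) A = Q A.
Hypothesis hindep : mutually_independent p.

(** The second Borel-Cantelli lemma. The probability that no p_k with
    n <= k < m lies in A_k is a product of factors 1 - Q(A_k) <= exp(- Q(A_k)),
    so it tends to 0 with m when the series diverges. *)
Lemma independent_infinitely_often (A : nat -> set R) :
  (forall k, measurable (A k)) -> (\sum_(k <oo) Q (A k) = +oo)%E ->
  {ae Pr, forall w, forall n, exists2 k, (n <= k)%N & A k (p k w)}.
Proof.
move=> mA Aoo; apply: ae_foralln => n.
pose N := \bigcap_(k in [set k | (n <= k)%N]) (p k @^-1` (~` A k)).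
have mN : measurable N.
  apply: bigcap_measurable; first by exists n => /=.
  move=> k _; rewrite -[X in measurable X]setTI.
  by apply: measurable_funPT => //; exact: measurableC.
exists N; split => //; last first.
  move=> w /= H k nk /= Ak; apply: H; by exists k.
pose q k := fine (Q (A k)).
have qE k : Q (A k) = (q k)%:E by rewrite fineK// fin_num_measure.
have q0 k : 0 <= q k by rewrite fine_ge0.
have q1 k : q k <= 1 by rewrite -lee_fin -qE probability_le1.
have PN m : (Pr N <= (expR (- \sum_(n <= k < m) q k))%:E)%E.
  have := @hindep (index_iota n m) (fun k => ~` A k) (iota_uniq _ _)
    (fun k => measurableC (mA k)).
  move=> E; apply: (@le_trans _ _
      (\prod_(k <- index_iota n m) Pr (p k @^-1` (~` A k)))%E).
    rewrite -E le_measure// ?inE//.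
      apply: bigcap_measurableType => k _; rewrite -[X in measurable X]setTI.
      by apply: measurable_funPT => //; exact: measurableC.
    by move=> w H k /=; rewrite mem_index_iota => /andP[nk _]; exact: H.
  rewrite (eq_bigr (fun k => (1 - q k)%:E)); last first.
    move=> k _; have := hdist k (measurableC (mA k)).
    by rewrite /distribution/= /pushforward => ->;
      rewrite probability_setC// qE.
  rewrite -sumrN expR_sum prodEFin lee_fin.
  apply: ler_prod => k _; rewrite subr_ge0 q1/=.
  exact: expR_ge1Dx.
apply/eqP; rewrite eq_le measure_ge0 andbT leNgt; apply/negP => PN0.
have : (\sum_(k <oo) Q (A k) <= (\sum_(0 <= k < n) q k - ln (fine (Pr
  N)))%:E)%E.
  apply: lime_le; first exact: is_cvg_nneseries.
  near=> m.
  have nm : (n <= m)%N by near: m; exists n.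
  rewrite (eq_bigr (fun k => (q k)%:E))// sumEFin lee_fin.
  rewrite (big_cat_nat (leq0n n) nm)//= lerD2l lerNr -ler_expR lnK; last first.
    by rewrite posrE fine_gt0// PN0/= -ge0_fin_numE// fin_num_measure.
  by rewrite -lee_fin fineK// fin_num_measure.
by rewrite Aoo.
Unshelve. all: by end_near. Qed.

End iid_io.

Section layer_cake.
Context {d : measure_display} {T : measurableType d} {R : realType}.

(** A real y >= 0 is at most 1 plus the number of positive integers k <= y;
    integrating this bounds the expectation by 1 plus the sum of the tail
    probabilities. *)
Lemma tail_sum_pinfty (Q : probability T R) (f : T -> R) :
  measurable_fun setT f -> (forall x, 0 <= f x) ->
  (\int[Q]_x (f x)%:E = +oo)%E ->
  (\sum_(k <oo) Q [set x | (k.+1%:R <= f x)%R] = +oo)%E.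
Proof.
move=> mf f0 foo.
pose A k := [set x | k.+1%:R <= f x].
have mA k : measurable (A k).
  rewrite (_ : A k = f @^-1` `[k.+1%:R, +oo[); last first.
    by apply/seteqP; split=> x /=; rewrite in_itv/= andbT.
  by rewrite -[X in measurable X]setTI; exact: mf.
apply/eqP; rewrite -leye_eq -foo; apply/negPn/negP; rewrite -ltNge => Alt.
have : (\int[Q]_x (f x)%:E <= 1 + \sum_(k <oo) Q (A k))%E.
  have -> : (1 + \sum_(k <oo) Q (A k) =
      \int[Q]_x (1 + \sum_(k <oo) (\1_(A k) x)%:E))%E.
    rewrite ge0_integralD//.
    - rewrite integral_nneseries//.
      + rewrite integral_cst// mul1e; congr (_ + _)%E.
          by apply/esym/probability_setT.
        by apply: eq_eseriesr => k _; rewrite integral_indic// setIT.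
      + by move=> k; exact/measurable_EFinP.
    - by move=> x _; apply: nneseries_ge0 => k _ _; rewrite lee_fin.
    - apply: ge0_emeasurable_sum => k; first by move=> x _ _; rewrite lee_fin.
      by move=> _; exact/measurable_EFinP.
  apply: ge0_le_integral => //.
  - by move=> x _; rewrite lee_fin.
  - exact/measurable_EFinP.
  - apply: emeasurable_funD => //.
    apply: ge0_emeasurable_sum => k; first by move=> x _ _; rewrite lee_fin.
    by move=> _; exact/measurable_EFinP.
  - move=> x _.
    have /andP[n1 n2] := truncn_itv (f0 x).
    pose n := Num.truncn (f x).
    apply: (@le_trans _ _ (n.+1%:R)%:E); first by rewrite lee_fin ltW.
    rewrite -natr1 addrC EFinD leeD2l//.
    apply: le_trans (@nneseries_lim_ge _ _ _ 0 n _); last first.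
      by move=> k _ _; rewrite lee_fin.
    have H k : (0 <= k < n)%N -> \1_(A k) x = 1 :> R.
      move=> /andP[_ kn]; rewrite indicE mem_set//= /A/= (le_trans _ n1)//.
      by rewrite ler_nat.
    by rewrite sumEFin lee_fin (eq_big_nat _ _ H) big_const_nat subn0
      iter_addr_0.
apply/negP; rewrite foo -ltNge lte_add_pinfty// ?ltry//.
by rewrite -foo.
Qed.

End layer_cake.

(** * Means along a polynomial subsequence *)

Section mean_along_powers.
Context {R : realType}.

Lemma ratio_succ_cvg1 : (n.+1%:R / n.+2%:R : R) @[n --> \oo] --> (1 : R).
Proof.
have -> : (fun n => n.+1%:R / n.+2%:R : R) = (fun n => 1 - n.+2%:R^-1).
  apply/funext => n; have -> : n.+1%:R = n.+2%:R - 1 :> R by rewrite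
    -[n.+2]addn1 natrD addrK.
  by rewrite mulrBl mul1r divff// pnatr_eq0.
rewrite -[X in _ --> X]subr0; apply: cvgB; first exact: cvg_cst.
have := @cvg_harmonic R; rewrite -cvg_shiftS; exact.
Qed.

(** For K between (n+1)^q and (n+2)^q, monotonicity of S bounds S K / K by the
    means at the two ends, up to the factor ((n+1)/(n+2))^q, which tends
    to 1. *)
Lemma cvg_mean_along_powers (S : nat -> R) (q : nat) (l : R) : (0 < q)%N ->
  (forall K, 0 <= S K) -> {homo S : m n / (m <= n)%N >-> m <= n} ->
  S (n.+1 ^ q)%N / (n.+1 ^ q)%:R @[n --> \oo] --> l ->
  S K / K%:R @[K --> \oo] --> l.
Proof.
move=> q0 S0 ndS Sl.
have /choice[phi phiP] K : exists n, (0 < K)%N ->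
    (n.+1 ^ q <= K < n.+2 ^ q)%N.
  case: K => [|K]; first by exists 0%N.
  have ex : exists i, (i.+1 ^ q <= K.+1)%N by exists 0%N; rewrite exp1n.
  have ub i : (i.+1 ^ q <= K.+1)%N -> (i <= K.+1)%N.
    move=> h; rewrite (leq_trans _ h)// ltnW// (leq_trans _ (leq_pexp2l _
      q0))//.
  exists (ex_maxn ex ub) => _; case: ex_maxnP => i iK imax; rewrite iK/= ltnNge.
  by apply/negP => /imax; rewrite ltnn.
have phioo : phi K @[K --> \oo] --> \oo.
  apply/cvgnyPge => N; near=> K.
  have K0 : (0 < K)%N by near: K; exists 1%N.
  have /andP[_ h] := phiP _ K0; rewrite -ltnS -ltnS -(ltn_exp2r _ _ q0).
  rewrite (leq_ltn_trans _ h)//; near: K; exists (N.+1 ^ q)%N => //=.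
pose a n := S (n.+1 ^ q)%N / (n.+1 ^ q)%:R.
pose r n : R := (n.+1%:R / n.+2%:R) ^+ q.
have r1 : r n @[n --> \oo] --> (1 : R).
  have := @exprn_continuous R q 1; rewrite /continuous_at expr1n => h.
  exact: (cvg_comp _ _ ratio_succ_cvg1 h).
have lo : a (phi K) * r (phi K) @[K --> \oo] --> l.
  have : a n * r n @[n --> \oo] --> l by rewrite -[l]mulr1; exact: cvgM.
  exact: cvg_comp.
have up : a (phi K).+1 / r (phi K) @[K --> \oo] --> l.
  have : a n.+1 / r n @[n --> \oo] --> l.
    rewrite -[l]mulr1 -[1]invr1; apply: cvgM; first by rewrite cvg_shiftS.
    by apply: cvgV => //; exact: oner_neq0.
  by move: (phi) phioo => f foo h; apply: (cvg_comp _ _ foo h).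
apply: squeeze_cvgr lo up; near=> K.
have K0 : (0 < K)%N by near: K; exists 1%N.
have /andP[h1 h2] := phiP _ K0.
have P0 i : 0 < (i.+1 ^ q)%:R :> R by rewrite ltr0n expn_gt0.
have KR : 0 < K%:R :> R by rewrite ltr0n.
rewrite /a /r expr_div_n -!natrX; apply/andP; split.
  rewrite [leLHS](_ : _ = S ((phi K).+1 ^ q)%N / ((phi K).+2 ^ q)%:R).
    rewrite ler_pM ?invr_ge0//; first exact: ndS.
    by rewrite lef_pV2 ?posrE// ler_nat ltnW.
  by field; rewrite !gt_eqF//.
rewrite [leRHS](_ : _ = S ((phi K).+2 ^ q)%N / ((phi K).+1 ^ q)%:R).
  rewrite ler_pM ?invr_ge0//; first by apply: ndS; exact: ltnW.
  by rewrite lef_pV2 ?posrE// ler_nat.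
by field; rewrite !gt_eqF//.
Unshelve. all: by end_near. Qed.

End mean_along_powers.

(** * The strong law of large numbers *)

Section strong_law.
Context {d : measure_display} {T : measurableType d} {R : realType}.
Context {Pr : probability T R} {Q : probability R R}.
Context {p : nat -> {RV Pr >-> R}}.
Hypothesis hdist : forall (k : nat) (A : set R),
  measurable A -> distribution Pr (p k) A = Q A.
Hypothesis hindep : mutually_independent p.

(** The moment of order 1 + e, rather than 1, is what makes both truncation
    errors decay like a power of the truncation level, so that one polynomial
    subsequence suffices. *)
Lemma strong_law_of_large_numbers (f : R -> R) (e : R) : 0 < e <= 1 ->
  measurable_fun setT f -> (forall x, 0 <= f x) ->
  (\int[Q]_x (f x `^ (1 + e))%:E < +oo)%E ->
  {ae Pr, forall w, (\sum_(k < K) f (p k w)) / K%:R @[K --> \oo] -->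
    fine (\int[Q]_x (f x)%:E)%E}.
Proof.
move=> /andP[e0 e1] mf f0 fe.
have mfe : measurable_fun setT (fun x => f x `^ (1 + e)).
  exact: (measurableT_comp (measurable_powR (1 + e)) mf).
pose C := fine (\int[Q]_x (f x `^ (1 + e))%:E)%E.
have CE : (\int[Q]_x (f x `^ (1 + e))%:E = C%:E)%E.
  rewrite fineK// ge0_fin_numE//.
  by apply: integral_ge0 => x _; rewrite lee_fin powR_ge0.
have C0 : 0 <= C.
  by apply: fine_ge0; apply: integral_ge0 => x _; rewrite lee_fin powR_ge0.
(* q e >= 2 makes K_n^(-e) summable, K_n = (n+1)^q being written N n. *)
pose q := (Num.truncn (2 / e)).+1.
have qe : 2 <= q%:R * e.
  rewrite -ler_pdivrMr// ltW//.
  by have /andP[_] := truncn_itv (divr_ge0 (ler0n R 2) (ltW e0)).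
pose N n := (n.+1 ^ q)%N.
pose c n : R := (N n)%:R.
have c0 n : 0 < c n by rewrite ltr0n expn_gt0.
have decay n : c n `^ (- e) <= n.+1%:R ^- 2.
  rewrite /c natrX -powR_mulrn// -powRrM mulrN powRN -powR_mulrn//.
  rewrite lef_pV2 ?posrE ?powR_gt0 ?ltr0n//.
  by apply: ler_powR => //; rewrite ler1n.
pose g n x := Num.min (f x) (c n).
pose h n x := f x - g n x.
have mg n : measurable_fun setT (g n) by exact: measurable_minr.
have mh n : measurable_fun setT (h n) by exact: measurable_funB.
have g0 n x : 0 <= g n x by rewrite le_min f0 ltW.
have gc n x : g n x <= c n by rewrite ge_min lexx orbT.
have gf n x : g n x <= f x by rewrite ge_min lexx.
have h0 n x : 0 <= h n x by rewrite subr_ge0.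
(* Where f > c, f = f^(1+e) f^(-e) <= c^(-e) f^(1+e). *)
have hle n x : h n x <= c n `^ (- e) * f x `^ (1 + e).
  rewrite /h /g; case: (leP (f x) (c n)) => [_|cf].
    by rewrite subrr mulr_ge0 ?powR_ge0.
  have fx0 : 0 < f x by exact: lt_trans cf.
  apply: (@le_trans _ _ (f x)); first by rewrite gerBl ltW.
  rewrite powRN mulrC ler_pdivlMr ?powR_gt0// powRD;
    last by rewrite (gt_eqF fx0) implybT.
  rewrite (powRr1 (ltW fx0)) ler_pM2l//.
  by apply: ge0_ler_powR; rewrite ?nnegrE ?ltW.
(* g^2 = g^(1-e) g^(1+e), with g <= c in the first factor, g <= f in the
   second. *)
have g2le n x : g n x ^+ 2 <= c n `^ (1 - e) * f x `^ (1 + e).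
  have -> : g n x ^+ 2 = g n x `^ (1 - e) * g n x `^ (1 + e).
    rewrite -powR_mulrn// -powRD; last by apply/implyP => /eqP; lra.
    by congr (_ `^ _); lra.
  apply: ler_pM; rewrite ?powR_ge0//.
    by apply: ge0_ler_powR; rewrite ?nnegrE ?subr_ge0 ?gc// ltW.
  by apply: ge0_ler_powR; rewrite ?nnegrE// ltW// addr_gt0.
have intle (u : R -> R) b : measurable_fun setT u -> (forall x, 0 <= u x) ->
    0 <= b -> (forall x, u x <= b * f x `^ (1 + e)) ->
    (\int[Q]_x (u x)%:E <= (b * C)%:E)%E.
  move=> mu u0 b0 ub; rewrite EFinM -CE -(ge0_integralZl_EFin Q measurableT)//.
  - apply: ge0_le_integral => //.
    + by move=> x _; rewrite lee_fin.
    + exact/measurable_EFinP.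
    + by apply/measurable_EFinP; exact: measurable_funM.
    + by move=> x _; rewrite lee_fin.
  - by move=> x _; rewrite lee_fin powR_ge0.
  - exact/measurable_EFinP.
pose eta n := fine (\int[Q]_x (h n x)%:E)%E.
have intdecay n : (\int[Q]_x (h n x)%:E <= (C / n.+1%:R ^+ 2)%:E)%E.
  have I1 := intle _ _ (mh n) (h0 n) (powR_ge0 _ _) (hle n).
  apply: (le_trans I1).
  by rewrite lee_fin mulrC ler_wpM2l.
have etaE n : (\int[Q]_x (h n x)%:E = (eta n)%:E)%E.
  rewrite fineK// ge0_fin_numE ?(le_lt_trans (intdecay n)) ?ltry//.
  by apply: integral_ge0 => x _; rewrite lee_fin.
pose mu_ n := fine (\int[Q]_x (g n x)%:E)%E.
have muE n : (\int[Q]_x (g n x)%:E = (mu_ n)%:E)%E.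
  rewrite fineK// ge0_fin_numE; last first.
    by apply: integral_ge0 => x _; rewrite lee_fin.
  apply: (@le_lt_trans _ _ (\int[Q]_x cst (c n)%:E x)%E).
    apply: ge0_le_integral => //.
    - by move=> x _; rewrite lee_fin.
    - exact/measurable_EFinP.
    - by move=> x _; rewrite lee_fin.
  rewrite integral_cst// [X in (_ * X)%E](_ : _ = 1%E) ?mule1 ?ltry//.
  exact: probability_setT.
set mu := fine _.
have muD n : mu_ n = mu - eta n.
  rewrite /mu (_ : (\int[Q]_x (f x)%:E = (mu_ n)%:E + (eta n)%:E)%E).
    by rewrite /= addrK.
  rewrite -muE -etaE -(ge0_integralD Q measurableT).
  - by apply: eq_integral => x _; rewrite -EFinD /h addrC subrK.
  - by move=> x _; rewrite lee_fin.
  - exact/measurable_EFinP.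
  - by move=> x _; rewrite lee_fin.
  - exact/measurable_EFinP.
have eta_cvg : eta n @[n --> \oo] --> (0 : R).
  have h2 : C * (n.+1%:R^-1 * n.+1%:R^-1) @[n --> \oo] --> (0 : R).
    rewrite -[X in _ --> X](mulr0 C) -[X in _ * X](mulr0 0).
    apply: cvgM; first exact: cvg_cst.
    by apply: cvgM; exact: cvg_harmonic.
  apply: squeeze_cvgr (cvg_cst (0 : R)) h2; near=> n.
  rewrite -invfM -expr2 -!lee_fin -etaE intdecay andbT.
  by apply: integral_ge0 => x _; rewrite lee_fin.
(* The mean of f is the sum of the mean of the excess f - g, which is Rm, of
   the centred mean of the truncation g, whose square is D, and of mu_. *)
pose Rm n w := (\sum_(k < N n) h n (p k w)) / c n.
pose D n w := ((\sum_(k < N n) g n (p k w) - (N n)%:R * mu_ n) / c n) ^+ 2.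
have mRm n : measurable_fun setT (Rm n).
  apply: measurable_funM => //; apply: measurable_sum => k.
  exact: measurableT_comp.
have mD n : measurable_fun setT (D n).
  apply: measurable_funX; apply: measurable_funM => //.
  apply: measurable_funB => //; apply: measurable_sum => k.
  exact: measurableT_comp.
have Rm0 n w : 0 <= Rm n w by rewrite divr_ge0 ?(ltW (c0 n))// sumr_ge0.
have Rm_cvg : {ae Pr, forall w, Rm n w @[n --> \oo] --> (0 : R)}.
  apply: summable_integral_ae_cvg0 => //.
  apply: le_lt_trans (nneseries_inv_sqr_lty C0).
  apply: lee_nneseries => n _.
    by move=> _; apply: integral_ge0 => x _; rewrite lee_fin.
  apply: le_trans (intdecay n); rewrite /Rm.
  under eq_integral => w _ do rewrite mulrC EFinM -sumEFin.
  rewrite (ge0_integralZl_EFin Pr measurableT).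
  - rewrite ge0_integral_sum//.
    + rewrite (eq_bigr (fun=> (eta n)%:E)).
        rewrite sumEFin sumr_const card_ord -EFinM etaE lee_fin.
        by rewrite -mulr_natl mulKf// gt_eqF// c0.
      move=> k _; rewrite -etaE.
      apply: (@ge0_expectation_comp _ _ _ _ _ _ hdist k (EFin \o h n)).
        exact/measurable_EFinP.
      by move=> x; rewrite lee_fin.
    + by move=> j; apply/measurable_EFinP; exact: measurableT_comp.
    + by move=> j w _; rewrite lee_fin.
  - by move=> w _; rewrite sume_ge0// => k _; rewrite lee_fin.
  - by apply: emeasurable_sum => k; apply/measurable_EFinP;
    exact: measurableT_comp.
  - by rewrite invr_ge0 ltW.
have D_cvg : {ae Pr, forall w, D n w @[n --> \oo] --> (0 : R)}.
  apply: summable_integral_ae_cvg0 => //.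
    by move=> n w; rewrite sqr_ge0.
  apply: le_lt_trans (nneseries_inv_sqr_lty C0).
  apply: lee_nneseries => n _.
    by move=> _; apply: integral_ge0 => x _; rewrite lee_fin sqr_ge0.
  rewrite /D; under eq_integral => w _ do rewrite expr_div_n mulrC EFinM.
  rewrite (ge0_integralZl_EFin Pr measurableT).
  - have gcc x : 0 <= g n x <= c n by rewrite g0 gc.
    have M := second_moment_sum_le hdist hindep (N n) (mg n) gcc (muE n).
    apply: (le_trans (lee_wpmul2l _ M));
      first by rewrite lee_fin invr_ge0 sqr_ge0.
    have I2 := intle _ _ (measurable_funX 2 (mg n)) (fun x => sqr_ge0 _)
      (powR_ge0 _ _) (g2le n).
    rewrite muleA -EFinM.
    apply: (le_trans (lee_wpmul2l _ I2)).
      by rewrite lee_fin mulr_ge0 ?invr_ge0 ?sqr_ge0.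
    rewrite -EFinM lee_fin mulrA [leRHS]mulrC ler_wpM2r//.
    apply: le_trans (decay n).
    rewrite powRD; last by rewrite (gt_eqF (c0 n)) implybT.
    rewrite (powRr1 (ltW (c0 n))) -/(c n) le_eqVlt; apply/orP; left; apply/eqP.
    by move: (c0 n); move: (c n) (_ `^ _) => z y z0; field; rewrite gt_eqF.
  - by move=> w _; rewrite lee_fin sqr_ge0.
  - apply/measurable_EFinP; apply: measurable_funX;
    apply: measurable_funB => //.
    by apply: measurable_sum => k; exact: measurableT_comp.
  - by rewrite invr_ge0 sqr_ge0.
near=> w.
have Rw : Rm n w @[n --> \oo] --> (0 : R) by near: w.
have Dw : D n w @[n --> \oo] --> (0 : R) by near: w.
apply: (@cvg_mean_along_powers R (fun K => \sum_(k < K) f (p k w)) q) => //.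
- by move=> K; rewrite sumr_ge0.
- move=> m n mn; rewrite -!(big_mkord xpredT (fun k => f (p k w))).
  by rewrite [leRHS](big_cat_nat (leq0n m) mn)/= lerDl sumr_ge0.
- have sD : (\sum_(k < N n) g n (p k w) - (N n)%:R * mu_ n) / c n
      @[n --> \oo] --> (0 : R).
    apply/norm_cvg0P.
    have := (cvg_comp _ _ Dw (@sqrt_continuous R 0)); rewrite sqrtr0.
    apply: cvg_trans; apply: near_eq_cvg; near=> n.
    by rewrite /= /D sqrtr_sqr.
  rewrite (_ : (fun n => _) = (fun n =>
      (\sum_(k < N n) g n (p k w) - (N n)%:R * mu_ n) / c n +
      Rm n w + (mu - eta n))).
    rewrite -[mu in X in _ --> X]subr0 -[X in _ --> X]add0r -[X in _ --> X +
      _]addr0.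
    apply: cvgD; first exact: cvgD.
    by apply: cvgB => //; exact: cvg_cst.
  apply/funext => n; rewrite -muD /Rm.
  rewrite (eq_bigr (fun k : 'I_(N n) => g n (p k w) + h n (p k w))); last first.
    by move=> k _; rewrite addrC subrK.
  by rewrite big_split/=; field; rewrite gt_eqF// c0.
Unshelve. all: by end_near. Qed.
End strong_law.

(** * Power moments of the distribution *)

Section moments.
Context {R : realType}.

Lemma epow_powR (x s : R) : 0 < x -> epow x%:E s = (x `^ s)%:E.
Proof.
move=> x0; rewrite /epow; case: ifP => // _.
by rewrite poweR_EFin inver gt_eqF ?powR_gt0// -powRN opprK.
Qed.

Lemma epow_ge0 (x s : R) : (0 <= epow x%:E s)%E.
Proof.
rewrite /epow; case: ifP => _; first by rewrite inve_ge0 poweR_ge0.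
by rewrite poweR_ge0.
Qed.

(** For negative s the function takes the value +oo at 0, where the real power
    is 0 by convention; away from 0 the two agree. *)
Lemma measurable_epow (s : R) :
  measurable_fun setT (fun x : R => epow x%:E s).
Proof.
have [s0|s0] := ltP s 0; last first.
  rewrite (_ : (fun x => _) = (fun x => (x `^ s)%:E)); last first.
    by apply/funext => x; rewrite /epow ltNge s0.
  by apply/measurable_EFinP; exact: measurable_powR.
rewrite (_ : (fun x => _) = (fun x => if x == 0 then +oo%E else (x `^ s)%:E)).
  apply: measurable_fun_ifT => //.
    apply: (measurable_fun_bool true).
    rewrite (_ : _ @^-1` _ = [set 0]) ?setTI//.
    by apply/seteqP; split => [_ /eqP ->//|_ -> /=]; rewrite eqxx.
  by apply/measurable_EFinP; exact: measurable_powR.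
apply/funext => x; rewrite /epow s0 poweR_EFin inver powR_eq0 oppr_eq0.
by rewrite (lt_eqF s0) andbT; case: eqP => // _; rewrite -powRN opprK.
Qed.

Variable Q : probability R R.

(** A finite moment of negative order forbids an atom at 0, where the integrand
    is infinite. *)
Lemma ae_pvalue : Q `[0, 1]%classic = 1%E -> (0 < moment_index Q)%E ->
  {ae Q, forall x : R, 0 < x <= 1}.
Proof.
move=> hQ /ereal_sup_gt[_ [m [m0 mfin] <-]]; rewrite lte_fin => {}m0.
have h01 : {ae Q, forall x : R, 0 <= x <= 1}.
  exists (~` `[0, 1]%classic); split.
  - exact: measurableC.
  - by rewrite probability_setC// hQ subee.
  - by move=> x /= H xi; apply: H; move: xi; rewrite in_itv.
have : Q.-integrable setT (fun x : R => epow x%:E (- m)).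
  apply/integrableP; split; first exact: measurable_epow.
  by under eq_integral => x _ do rewrite gee0_abs ?epow_ge0//.
move=> /(integrable_ae measurableT) hfin.
move: h01 hfin; apply: filterS2 => x /andP[x0 ->] /(_ I).
rewrite andbT lt_neqAle x0 andbT; apply: contraTneq => <-.
rewrite /epow oppr_lt0 m0 opprK poweR_EFin powR0 ?gt_eqF// inve0//.
Qed.

Hypothesis aeQ : {ae Q, forall x : R, 0 < x <= 1}.

Lemma integral_epowE s : (\int[Q]_x epow x%:E s = \int[Q]_x (x `^ s)%:E)%E.
Proof.
apply: ge0_ae_eq_integral => //.
- exact: measurable_epow.
- by apply/measurable_EFinP; exact: measurable_powR.
- by move=> x _; exact: epow_ge0.
- by move=> x _; rewrite lee_fin powR_ge0.
- by move: aeQ; apply: filterS => x /andP[x0 _] _; rewrite epow_powR.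
Qed.

Lemma ae_le_power_moment s t : s <= t ->
  (\int[Q]_x (x `^ t)%:E <= \int[Q]_x (x `^ s)%:E)%E.
Proof.
move=> st; apply: ae_ge0_le_integral => //.
- by move=> x _; rewrite lee_fin powR_ge0.
- by apply/measurable_EFinP; exact: measurable_powR.
- by move=> x _; rewrite lee_fin powR_ge0.
- by apply/measurable_EFinP; exact: measurable_powR.
- by move: aeQ; apply: filterS => x x01 _; rewrite lee_fin ger_powR.
Qed.

(** The smaller the exponent, the larger the power of a number of ]0, 1], so
    every exponent above the negative of an admissible order inherits its
    finiteness. *)
Lemma power_moment_lty r : (- moment_index Q < r%:E)%E ->
  (\int[Q]_x (x `^ r)%:E < +oo)%E.
Proof.
rewrite lteNl -EFinN => h.
have [r0|r0] := leP 0 r.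
  apply: (le_lt_trans (ae_le_power_moment r0)).
  under eq_integral do rewrite powRr0.
  by rewrite integral_cst// [X in (_ * X)%E](_ : _ = 1%E) ?mule1 ?ltry//;
    exact: probability_setT.
have /ereal_sup_gt[_ [m [m0 mfin] <-]] := h; rewrite lte_fin => rm.
apply: le_lt_trans mfin; rewrite integral_epowE.
by apply: ae_le_power_moment; lra.
Qed.

Lemma power_moment_gt0 r : (0 < \int[Q]_x (x `^ r)%:E)%E.
Proof.
rewrite lt_neqAle eq_sym integral_ge0; last by move=> x _;
  rewrite lee_fin powR_ge0.
rewrite andbT; apply/negP => /eqP E0.
have := @ae_eq_integral_abs _ _ _ Q setT measurableT (fun x : R => (x `^ r)%:E).
have -> : (\int[Q]_x `|(x `^ r)%:E| = 0)%E.
  by rewrite -[RHS]E0; apply: eq_integral => x _;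
    rewrite gee0_abs// lee_fin powR_ge0.
have mp : measurable_fun setT (fun x : R => (x `^ r)%:E).
  by apply/measurable_EFinP; exact: measurable_powR.
move=> /(_ mp) [/(_ erefl) H _].
have pf : ProperFilter (almost_everywhere Q).
  apply: ae_properfilter_algebraOfSetsType.
  by rewrite [ltRHS](_ : _ = 1%E)//; exact: probability_setT.
have : \forall x \ae Q, False.
  move: aeQ H; apply: filterS2 => x /andP[x0 _] /(_ I) [] /eqP.
  by rewrite gt_eqF// powR_gt0.
by move=> /filter_ex[].
Qed.

Lemma power_moment_pinfty m : 0 <= m -> (moment_index Q < m%:E)%E ->
  (\int[Q]_x (x `^ (- m))%:E = +oo)%E.
Proof.
move=> m0 Pm; apply/eqP; rewrite -leye_eq leNgt; apply/negP => fin.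
have : (m%:E <= moment_index Q)%E.
  by apply: ereal_sup_ubound; exists m => //; split => //;
    rewrite integral_epowE.
by rewrite leNgt Pm.
Qed.

End moments.

(** * Almost sure growth of power sums *)

Lemma sum_powR_gt0 {R : realType} (x : nat -> R) (s : R) (K : nat) :
  (0 < K)%N -> (forall k, 0 < x k) -> 0 < \sum_(k < K) x k `^ s.
Proof.
case: K => // K _ x0; rewrite big_ord_recl ltr_wpDr ?powR_gt0//.
by rewrite sumr_ge0// => i _; rewrite powR_ge0.
Qed.

Section pvalue_sequences.
Context {d : measure_display} {T : measurableType d} {R : realType}.
Context {Pr : probability T R} {Q : probability R R}.
Context {p : nat -> {RV Pr >-> R}}.
Hypothesis hdist : forall (k : nat) (A : set R),
  measurable A -> distribution Pr (p k) A = Q A.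
Hypothesis hindep : mutually_independent p.
Hypothesis aeQ : {ae Q, forall x : R, 0 < x <= 1}.

Lemma ae_distribution k (P : R -> Prop) :
  {ae Q, forall x, P x} -> {ae Pr, forall w, P (p k w)}.
Proof.
move=> [N [mN N0 PN]]; exists (p k @^-1` N); split.
- by rewrite -[X in measurable X]setTI; exact: measurable_funPT.
- by rewrite -N0 -(hdist k mN).
- by move=> w /= nP; apply: PN.
Qed.

Lemma ae_pvalues : {ae Pr, forall w, forall k, 0 < p k w <= 1}.
Proof. by apply: ae_foralln => k; exact: (ae_distribution k aeQ). Qed.

(** The strict inequality - Pi < r leaves room for the moment of order 1 + e
    that the strong law requires: for r < 0 and an admissible m > - r, any
    e <= m / (- r) - 1 will do. *)
Lemma ae_mean_power r : (- moment_index Q < r%:E)%E ->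
  {ae Pr, forall w, (\sum_(k < K) p k w `^ r) / K%:R @[K --> \oo] -->
    fine (\int[Q]_x (x `^ r)%:E)%E}.
Proof.
move=> Pr0.
suff [e /andP[e0 e1] fe] : exists2 e : R, 0 < e <= 1 &
    (\int[Q]_x (x `^ (r * (1 + e)))%:E < +oo)%E.
  have fe' : (\int[Q]_x ((x `^ r) `^ (1 + e))%:E < +oo)%E.
    by under eq_integral => x _ do rewrite -powRrM.
  have e01 : 0 < e <= 1 by rewrite e0 e1.
  exact: (strong_law_of_large_numbers hdist hindep e01 (measurable_powR r)
    (fun x => powR_ge0 x r) fe').
have [r0|r0] := leP 0 r.
  exists 1; first by rewrite ltr01 lexx.
  apply: power_moment_lty => //; apply: lt_le_trans Pr0 _.
  by rewrite lee_fin ler_peMr// lerDl.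
have : ((- r)%:E < moment_index Q)%E by rewrite EFinN lteNl.
move=> /ereal_sup_gt[_ [m [m0 mfin] <-]]; rewrite lte_fin => rm.
exists (Num.min 1 (m / - r - 1)).
  by rewrite lt_min ltr01 subr_gt0 ltr_pdivlMr ?oppr_gt0// mul1r rm ge_min lexx.
apply: le_lt_trans mfin; rewrite integral_epowE//;
  apply: ae_le_power_moment => //.
rewrite -lerN2 opprK -mulNr -ler_pdivlMl ?oppr_gt0// [leRHS]mulrC -lerBrDl.
by rewrite ge_min lexx orbT.
Qed.

(** The logarithm is square integrable because (ln x)^2 <= (4 / m^2) x^(-m) on
    ]0, 1], a consequence of y <= exp y at y = - (m / 2) ln x. *)
Lemma ae_mean_ln : (0 < moment_index Q)%E ->
  exists l : R, (\int[Q]_x lne x%:E = l%:E)%E /\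
  {ae Pr, forall w, (\sum_(k < K) ln (p k w)) / K%:R @[K --> \oo] --> l}.
Proof.
move=> /ereal_sup_gt[_ [m [_ mfin] <-]]; rewrite lte_fin => m0.
have mabs : measurable_fun setT (fun x : R => `|ln x|).
  by apply: measurableT_comp => //; exact: measurable_ln.
have fin2 : (\int[Q]_x (`|ln x| `^ (1 + 1))%:E < +oo)%E.
  apply: (@le_lt_trans _ _ ((4 / m ^+ 2)%:E * \int[Q]_x epow x%:E (- m))%E).
    rewrite integral_epowE// -(ge0_integralZl_EFin Q measurableT); first last.
    - by rewrite divr_ge0// sqr_ge0.
    - by apply/measurable_EFinP; exact: measurable_powR.
    - by move=> x _; rewrite lee_fin powR_ge0.
    apply: ae_ge0_le_integral => //.
    - apply/measurable_EFinP.
      exact: (measurableT_comp (measurable_powR (1 + 1)) mabs).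
    - by move=> x _; rewrite mule_ge0// lee_fin ?powR_ge0// divr_ge0// sqr_ge0.
    - by apply/measurable_EFinP; apply: measurable_funM => //;
      exact: measurable_powR.
    - move: aeQ; apply: filterS => x /andP[x0 x1] _.
      rewrite -EFinM lee_fin -[1 + 1]/(2%:R) powR_mulrn//.
      rewrite ler0_norm ?ln_le0// /powR gt_eqF//.
      set t := - ln x; have t0 : 0 <= t by rewrite oppr_ge0 ln_le0.
      rewrite mulNr -mulrN -/t.
      have -> : expR (m * t) = expR (m * t / 2) ^+ 2.
        by rewrite -expRM_natl; congr expR; field.
      rewrite mulrAC ler_pdivlMr ?exprn_gt0//.
      have -> : t ^+ 2 * m ^+ 2 = 4 * (m * t / 2) ^+ 2 by field.
      rewrite ler_pM2l// lerXn2r ?nnegrE ?expR_ge0//.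
        by rewrite divr_ge0// mulr_ge0// ltW.
      by rewrite (le_trans _ (expR_ge1Dx _))// lerDr.
  by rewrite lte_mul_pinfty// ?lee_fin// divr_ge0// sqr_ge0.
have fin1 : (\int[Q]_x (`|ln x|)%:E < +oo)%E.
  apply: (@le_lt_trans _ _ (\int[Q]_x (1 + (`|ln x| `^ (1 + 1))%:E))%E).
    apply: ge0_le_integral => //.
    - exact/measurable_EFinP.
    - apply: emeasurable_funD => //; apply/measurable_EFinP.
      exact: (measurableT_comp (measurable_powR (1 + 1)) mabs).
    - move=> x _; rewrite -EFinD lee_fin -[1 + 1]/(2%:R) powR_mulrn//.
      have := sqr_ge0 (`|ln x| - 1); have := normr_ge0 (ln x); nra.
  rewrite (ge0_integralD Q measurableT)//.
  - rewrite lte_add_pinfty// integral_cst// [X in (_ * X)%E](_ : _ = 1%E)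
    ?mule1 ?ltry//; exact: probability_setT.
  - apply/measurable_EFinP;
    exact: (measurableT_comp (measurable_powR (1 + 1)) mabs).
have e01 : 0 < (1 : R) <= 1 by rewrite ltr01 lexx.
exists (- fine (\int[Q]_x (`|ln x|)%:E)%E); split.
  rewrite EFinN fineK; last first.
    by rewrite ge0_fin_numE// integral_ge0// => x _; rewrite lee_fin.
  rewrite -integral_ge0N; last by move=> x _; rewrite lee_fin.
  apply: ae_eq_integral => //.
  - rewrite (_ : (fun x => _) = (fun x : R => if x <= 0 then -oo%E else (ln
    x)%:E))//.
    apply: measurable_fun_ifT => //; first exact: measurable_fun_ler.
    by apply/measurable_EFinP; exact: measurable_ln.
  - by apply: measurableT_comp => //; exact/measurable_EFinP.
  - move: aeQ; apply: filterS => x /andP[x0 x1] _ /=.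
    by rewrite leNgt x0/= ler0_norm ?ln_le0// opprK.
have := strong_law_of_large_numbers hdist hindep e01 mabs (fun x => normr_ge0
  _) fin2.
move: ae_pvalues; apply: filterS2 => w wp wl.
apply: cvg_trans (cvgN wl); apply: near_eq_cvg; near=> K => /=.
rewrite fctE -mulNr -sumrN; congr (_ / _); apply: eq_bigr => k _.
by have /andP[_ x1] := wp k; rewrite ler0_norm ?ln_le0// opprK.
Unshelve. all: by end_near. Qed.

Let invPi := fine (moment_index Q)^-1%E.

(** Exponents are parametrised by t = 1/m, so that Pi = +oo becomes the
    ordinary value 1/Pi = 0. *)
Lemma lt_moment_index t : (0 < moment_index Q)%E -> invPi < t ->
  0 < t /\ ((t^-1)%:E < moment_index Q)%E.
Proof.
rewrite /invPi; case: (moment_index Q) => [y| |]//.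
  rewrite lte_fin => y0; rewrite inver gt_eqF//= => yt.
  have t0 : 0 < t by apply: lt_trans yt; rewrite invr_gt0.
  by split => //; rewrite lte_fin -[ltRHS]invrK ltf_pV2 ?posrE ?invr_gt0.
by move=> _ /= t0; rewrite ltry.
Qed.

Lemma gt_moment_index t : (0 < moment_index Q)%E -> 0 < t -> t < invPi ->
  (moment_index Q < (t^-1)%:E)%E.
Proof.
rewrite /invPi; case: (moment_index Q) => [y| |]//.
  rewrite lte_fin => y0; rewrite inver gt_eqF//= => t0 yt.
  by rewrite lte_fin -[ltLHS]invrK ltf_pV2 ?posrE ?invr_gt0.
by move=> _ /= t0; rewrite ltNge ltW.
Qed.

(** The sum of the p_k^(-1/t) is at most (l + 1) K for large K, where l is the
    moment of order - 1/t; the power - t reverses the inequality. *)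
Lemma ae_power_sum_bound t : (0 < moment_index Q)%E -> invPi < t ->
  exists2 C : R, 0 < C &
  {ae Pr, forall w, \forall K \near \oo,
    C * K%:R `^ (- t) <= (\sum_(k < K) p k w `^ (- t^-1)) `^ (- t)}.
Proof.
move=> Pi0 /(lt_moment_index Pi0)[t0 tPi].
have := @ae_mean_power (- t^-1); rewrite EFinN lteN2 => /(_ tPi).
set l := fine _ => ml.
have l0 : 0 <= l by apply: fine_ge0; apply: integral_ge0 => x _;
  rewrite lee_fin powR_ge0.
have l1 : 0 < l + 1 by rewrite ltr_wpDl.
exists ((l + 1) `^ (- t)); first exact: powR_gt0.
move: ae_pvalues ml; apply: filterS2 => w wp wl; near=> K.
have K0 : (0 < K)%N by near: K; exists 1%N.
rewrite -powRM ?(ltW l1)//.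
have S0 := sum_powR_gt0 (- t^-1) K0 (fun k => proj1 (andP (wp k))).
rewrite !powRN lef_pV2 ?posrE ?powR_gt0 ?mulr_gt0 ?ltr0n//.
apply: ge0_ler_powR; rewrite ?nnegrE ?(ltW t0) ?(ltW S0) ?mulr_ge0 ?(ltW l1)//.
rewrite -ler_pdivrMr ?ltr0n//; near: K.
apply: (cvgr_le _ wl).
by rewrite ltrDl.
Unshelve. all: by end_near. Qed.

(** For t < 1/Pi the moment of order - 1/t is infinite, so that the events
    p_k^(-1/t) >= k + 1 have a divergent total probability and occur infinitely
    often. *)
Lemma ae_small_pvalues t : (0 < moment_index Q)%E -> 0 < t -> t < invPi ->
  {ae Pr, forall w, forall n, exists2 k, (n <= k)%N &
    p k w <= k.+1%:R `^ (- t)}.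
Proof.
move=> Pi0 t0 tPi.
have mf : measurable_fun setT (fun x : R => x `^ (- t^-1)) by exact:
  measurable_powR.
have := tail_sum_pinfty mf (fun x => powR_ge0 _ _)
  (power_moment_pinfty aeQ (_ : 0 <= t^-1) (gt_moment_index Pi0 t0 tPi)).
rewrite invr_ge0 (ltW t0) => /(_ isT) Soo.
have mA k : measurable [set x : R | k.+1%:R <= x `^ (- t^-1)].
  rewrite (_ : mkset _ = (fun x : R => x `^ (- t^-1)) @^-1` `[k.+1%:R, +oo[);
    last first.
    by apply/seteqP; split=> x /=; rewrite in_itv/= andbT.
  by rewrite -[X in measurable X]setTI; exact: mf.
have := independent_infinitely_often hdist hindep mA Soo.
move: ae_pvalues; apply: filterS2 => w wp wio n.
have [k nk /= wk] := wio n; exists k => //.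
have /andP[x0 _] := wp k.
have /= := ge0_ler_powR (ltW t0) (_ : k.+1%:R \in Num.nneg)
  (_ : p k w `^ (- t^-1) \in Num.nneg) wk.
rewrite !nnegrE ler0n powR_ge0 => /(_ isT isT).
rewrite -powRrM mulNr mulVf ?gt_eqF// powR_inv1 ?(ltW x0)// => h.
by rewrite powRN -[leLHS]invrK lef_pV2 ?posrE ?invr_gt0 ?powR_gt0 ?ltr0n.
Qed.

(** The events u_K <= M have an almost surely empty upper limit, so even the
    probability of their tail unions tends to 0. *)
Lemma ae_pinfty_in_probability (u : nat -> T -> R) :
  (forall K, measurable_fun setT (u K)) ->
  {ae Pr, forall w, u K w @[K --> \oo] --> +oo} ->
  cvg_infty_in_probability Pr u.
Proof.
move=> mu uoo M.
pose F K := [set w | u K w <= M].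
have mF K : measurable (F K).
  rewrite (_ : F K = u K @^-1` `]-oo, M]); last first.
    by apply/seteqP; split=> x /=; rewrite in_itv.
  by rewrite -[X in measurable X]setTI; exact: mu.
have lim0 : Pr (lim_sup_set F) = 0%E.
  case: uoo => N [mN N0 HN].
  apply: (subset_measure0 _ mN _ N0).
    by apply: bigcap_measurable => // n _; apply: bigcup_measurable.
  move=> w Fw; apply: HN => /= woo.
  have /(_ _ M) := (cvgryPgt _).1 woo.
  move=> [n _ /= Hn]; have [k nk] := Fw n I.
  by rewrite /F /= leNgt Hn.
have c0 : Pr (F K) @[K --> \oo] --> 0%E.
  have mU n : measurable (\bigcup_(k in [set k | (n <= k)%N]) F k).
    exact: bigcup_measurable.
  have := lim_sup_set_cvg Pr F mF; rewrite [X in _ --> X](_ : _ = 0%E)// => tl.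
  have {}tl := tl (le_lt_trans (probability_le1 Pr (mU 0%N)) (ltry 1)).
   apply: (squeeze_cvge _ (cvg_cst 0%E) tl); near=> K; rewrite measure_ge0/=.
  apply: le_measure; rewrite ?inE//.
  by apply: bigcup_sup => /=.
have -> : (fun K => Pr [set w | M < u K w]) = (fun K => 1 - Pr (F K))%E.
  apply/funext => K; rewrite -probability_setC//; congr (Pr _).
  by apply/seteqP; split => w /=; rewrite ltNge; [move/negP|move/negP].
rewrite -[X in _ --> X]sube0; apply: cvgeB => //; exact: cvg_cst.
Unshelve. all: by end_near. Qed.

End pvalue_sequences.

(** * Merged values of a fixed sequence *)

Section deterministic.
Context {R : realType}.
Implicit Types (x : nat -> R) (r s : R) (K : nat).

Lemma cvg_powR_const (u : nat -> R) (l s : R) : 0 < l ->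
  u n @[n --> \oo] --> l -> u n `^ s @[n --> \oo] --> l `^ s.
Proof.
move=> l0 ul.
have c : {for l, continuous (fun a : R => a `^ s)}.
  apply/differentiable_continuous/derivable1_diffP.
  by apply: derivable_powR; rewrite in_itv/= l0.
exact: (cvg_comp _ _ ul c).
Qed.

Lemma cvg_natr_powR_pinfty (s : R) : 0 < s ->
  K%:R `^ s @[K --> \oo] --> (+oo : set_system R).
Proof.
move=> s0; apply/cvgryPge => A; near=> K.
have [A0|A0] := ltP A 0; first by rewrite (le_trans (ltW A0)) ?powR_ge0.
have -> : A = (A `^ s^-1) `^ s by rewrite -powRrM mulVf ?gt_eqF// powRr1.
apply: ge0_ler_powR; rewrite ?nnegrE ?powR_ge0 ?(ltW s0)//.
near: K; exact: nbhs_infty_ger.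
Unshelve. all: by end_near. Qed.

Lemma cvg_natr_powR_0 (s : R) : s < 0 ->
  K%:R `^ s @[K --> \oo] --> (0 : R).
Proof.
rewrite -oppr_gt0 => s0.
have -> : (fun K => K%:R `^ s : R) = (fun K => (K%:R `^ (- s))^-1).
  by apply/funext => K; rewrite powRN invrK.
have pos : \forall K \near \oo, 0 < K%:R `^ (- s) :> R.
  by exists 1%N => // K /= K0; apply: powR_gt0; rewrite ltr0n.
exact/(gtr0_cvgV0 pos)/cvg_natr_powR_pinfty.
Qed.

Lemma power_meanE r K x : r != 0 -> (forall k, 0 < x k) -> (0 < K)%N ->
  power_mean r%:E K x = ((\sum_(k < K) x k `^ r) / K%:R) `^ r^-1.
Proof.
move=> r0 x0 K0; rewrite /power_mean (negbTE r0).
under eq_bigr => k _ do rewrite epow_powR//.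
by rewrite sumEFin -EFinM epow_powR// divr_gt0 ?ltr0n// sum_powR_gt0.
Qed.

Lemma power_mean0E K x : (forall k, 0 < x k) ->
  power_mean 0%:E K x = expR ((\sum_(k < K) ln (x k)) / K%:R).
Proof.
move=> x0; have lnE : \sum_(k < K) ln (x k) = ln (\prod_(k < K) x k).
  elim: K => [|K IH]; first by rewrite !big_ord0 ln1.
  by rewrite !big_ord_recr/= lnM ?posrE ?prodr_gt0// IH.
by rewrite /power_mean eqxx /powR gt_eqF ?prodr_gt0// mulrC lnE.
Qed.

(** The next two identities isolate the power of K: the factor K^(-1/r) coming
    from the average is kept when -1 < r, and becomes K itself when r < -1,
    because the constant then contributes K^(1 + 1/r). *)
Lemma merged_gtN1E r K x : -1 < r -> r < 0 ->
  (forall k, 0 < x k) -> (0 < K)%N ->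
  merged r%:E K x = (r + 1) `^ r^-1 * (K%:R `^ (- r^-1) *
    (\sum_(k < K) x k `^ r) `^ r^-1).
Proof.
move=> r1 r0 x0 K0; rewrite /merged /avg_coef r1 /succ_root lt_eqF//.
rewrite power_meanE ?lt_eqF//; congr (_ * _).
have S0 := sum_powR_gt0 r K0 x0.
rewrite (powRM _ (ltW S0)) ?invr_ge0//.
by rewrite mulrC -(powR_inv1 (ler0n _ K)) -powRrM mulN1r.
Qed.

Lemma merged_ltN1E r K x : r < -1 ->
  (forall k, 0 < x k) -> (0 < K)%N ->
  merged r%:E K x = r / (r + 1) * (K%:R `^ 1 *
    (\sum_(k < K) x k `^ r) `^ r^-1).
Proof.
move=> r1 x0 K0; have r0 : r < 0 by lra.
rewrite /merged power_meanE ?(lt_eqF r0)//.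
rewrite /avg_coef ltNge (ltW r1)/= (lt_eqF r1) -mulrA; congr (_ * _).
have S0 := sum_powR_gt0 r K0 x0.
have KR : 0 < K%:R :> R by rewrite ltr0n.
rewrite (powRM _ (ltW S0)) ?invr_ge0// -(powR_inv1 (ler0n _ K)) -powRrM mulN1r.
rewrite mulrCA mulrA -mulrA -powRD; last by rewrite (gt_eqF KR) implybT.
by rewrite [RHS]mulrC; congr (_ * _ `^ _); rewrite addrK.
Qed.

Lemma powRN_le (a b t : R) : 0 < a -> a <= b -> 0 <= t ->
  b `^ (- t) <= a `^ (- t).
Proof.
move=> a0 ab t0; have b0 := lt_le_trans a0 ab.
rewrite !powRN lef_pV2 ?posrE ?powR_gt0//.
by apply: ge0_ler_powR; rewrite ?nnegrE ?(ltW a0) ?(ltW b0).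
Qed.

Lemma le_sum_powR x s K j : (j < K)%N -> x j `^ s <= \sum_(k < K) x k `^ s.
Proof.
move=> jK; rewrite (bigD1 (Ordinal jK))//= lerDl sumr_ge0// => i _.
exact: powR_ge0.
Qed.

Lemma power_sum_root_le x m K j : 0 < m -> 0 < x j -> (j < K)%N ->
  (\sum_(k < K) x k `^ (- m)) `^ (- m^-1) <= x j.
Proof.
move=> m0 x0 jK.
apply: le_trans (powRN_le _ (le_sum_powR x (- m) jK) _) _.
- exact: powR_gt0.
- by rewrite invr_ge0 ltW.
- by rewrite -powRrM mulrNN divff ?gt_eqF// powRr1// ltW.
Qed.

(** The norm of l^s decreases in s, here applied to the inverses of the x_k and
    raised to the power -1: since each x_k^(-m) is at most their sum A, we have
    x_k^(-s) <= x_k^(-m) A^(s/m - 1), and summation over k gives A^(s/m). *)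
Lemma power_sum_root_homo x s m K : 0 < m <= s -> (forall k, 0 < x k) ->
  (0 < K)%N ->
  (\sum_(k < K) x k `^ (- m)) `^ (- m^-1) <=
  (\sum_(k < K) x k `^ (- s)) `^ (- s^-1).
Proof.
move=> /andP[m0 ms] x0 K0; have s0 := lt_le_trans m0 ms.
set A := \sum_(k < K) x k `^ (- m).
have A0 : 0 < A by exact: sum_powR_gt0.
have -> : A `^ (- m^-1) = (A `^ (s / m)) `^ (- s^-1).
  by rewrite -powRrM; congr (_ `^ _); field; rewrite !gt_eqF.
apply: powRN_le; rewrite ?invr_ge0 ?(ltW s0) ?sum_powR_gt0//.
have sm : 0 < s / m by rewrite divr_gt0.
rewrite -(mulr_powRB1 (ltW A0) sm) mulr_suml; apply: ler_sum => k _.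
have -> : x k `^ (- s) = (x k `^ (- m)) `^ (s / m).
  by rewrite -powRrM; congr (_ `^ _); field; rewrite gt_eqF.
rewrite -(mulr_powRB1 (powR_ge0 _ _) sm) ler_wpM2l ?powR_ge0//.
apply: ge0_ler_powR; rewrite ?nnegrE ?powR_ge0 ?(ltW A0)//.
  by rewrite subr_ge0 ler_pdivlMr// mul1r.
exact: le_sum_powR.
Qed.

Lemma rate_pinfty (u v : nat -> R) (c C g t b : R) : 0 < c -> 0 < C ->
  b < g - t ->
  (\forall K \near \oo, u K = c * (K%:R `^ g * v K)) ->
  (\forall K \near \oo, C * K%:R `^ (- t) <= v K) ->
  u K / K%:R `^ b @[K --> \oo] --> +oo.
Proof.
move=> c0 C0 bgt uE vC; apply/cvgryPge => A.
have gtb : 0 < g - t - b by rewrite subr_gt0.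
have cC0 : 0 < c * C by rewrite mulr_gt0.
have /cvgryPge/(_ (A / (c * C))) := cvg_natr_powR_pinfty gtb.
move=> big; near=> K.
have K0 : 0 < K%:R :> R by rewrite ltr0n; near: K; exists 1%N.
have -> : u K = c * (K%:R `^ g * v K) by near: K.
rewrite ler_pdivlMr ?powR_gt0//.
apply: (@le_trans _ _ (c * (K%:R `^ g * (C * K%:R `^ (- t))))); last first.
  by rewrite ler_pM2l// ler_pM2l ?powR_gt0//; near: K.
have -> : c * (K%:R `^ g * (C * K%:R `^ (- t))) = c * C * K%:R `^ (g - t).
  by rewrite powRD ?(gt_eqF K0) ?implybT//; ring.
rewrite -ler_pdivlMr ?powR_gt0//.
have -> : c * C * K%:R `^ (g - t) / K%:R `^ b = c * C * K%:R `^ (g - t - b).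
  by rewrite [in RHS]powRB ?(gt_eqF K0) ?implybT// mulrA.
by rewrite -ler_pdivrMl// mulrC; near: K.
Unshelve. all: by end_near. Qed.

(** The upper bound on v is used at k + 1 because a term of index k enters the
    sample only once its size reaches k + 1. *)
Lemma rate_limn_einf0 (u v : nat -> R) (c g t b : R) : 0 < c ->
  g - t < b -> (forall K, 0 <= v K) ->
  (forall K, (0 < K)%N -> u K = c * (K%:R `^ g * v K)) ->
  (forall n, exists2 k, (n <= k)%N & v k.+1 <= k.+1%:R `^ (- t)) ->
  limn_einf (fun K => (u K / K%:R `^ b)%:E) = 0%E.
Proof.
move=> c0 gtb v0 uE vio.
rewrite limn_einf_lim; apply: lim_near_cst => //; near=> n.
have n0 : (0 < n)%N by near: n; exists 1%N.
apply/eqP; rewrite eq_le; apply/andP; split; last first.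
  apply: le_ereal_inf_tmp => _ [K /= nK <-].
  rewrite lee_fin uE ?(leq_trans n0)// divr_ge0 ?powR_ge0//.
  by rewrite !mulr_ge0 ?powR_ge0 ?(ltW c0).
apply/lee_addgt0Pr => e e0; rewrite add0e.
have dlt : g - t - b < 0 by rewrite subr_lt0.
have /cvgrPdist_lt/(_ (e / c)) := cvg_natr_powR_0 dlt.
rewrite divr_gt0// => /(_ isT)[N _ HN].
have [k /= Nk vk] := vio (maxn N n).
apply: (@le_trans _ _ (u k.+1 / k.+1%:R `^ b)%:E).
  apply: ereal_inf_lbound; exists k.+1 => //=.
  by rewrite (leq_trans _ (leqnSn k))// (leq_trans _ Nk)// leq_maxr.
have /HN : (N <= k.+1)%N.
  by rewrite (leq_trans _ (leqnSn k))// (leq_trans _ Nk)// leq_maxl.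
rewrite /= sub0r normrN ger0_norm ?powR_ge0// ltr_pdivlMr// => /ltW h.
rewrite lee_fin (le_trans _ h)// uE// ler_pdivrMr ?powR_gt0 ?ltr0n//
  [leRHS]mulrAC.
have -> : k.+1%:R `^ (g - t - b) * k.+1%:R `^ b = k.+1%:R `^ g * k.+1%:R `^ (-
  t) :> R.
  by rewrite -!powRD ?pnatr_eq0 ?implybT// subrK.
rewrite [leRHS]mulrC ler_pM2l//.
by rewrite ler_wpM2l ?powR_ge0.
Unshelve. all: by end_near. Qed.
End deterministic.

(** * The convergent cases *)

Section limits.
Context {d : measure_display} {T : measurableType d} {R : realType}.
Context {Pr : probability T R} {Q : probability R R}.
Context {p : nat -> {RV Pr >-> R}}.
Hypothesis hdist : forall (k : nat) (A : set R),
  measurable A -> distribution Pr (p k) A = Q A.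
Hypothesis hindep : mutually_independent p.
Hypothesis aeQ : {ae Q, forall x : R, 0 < x <= 1}.
Hypothesis Pi0 : (0 < moment_index Q)%E.

Let P (r : \bar R) (K : nat) (w : T) : R := merged r K (fun k => p k w).

Lemma ae_exists_pvalue (A : set R) : measurable A -> (0 < Q A)%E ->
  {ae Pr, forall w, exists k, A (p k w)}.
Proof.
move=> mA A0.
have Aoo : (\sum_(k <oo) Q A = +oo)%E.
  have qE : Q A = (fine (Q A))%:E by rewrite fineK// fin_num_measure.
  have q0 : 0 < fine (Q A) by rewrite -lte_fin -qE.
  apply/eqyP => M M0.
  pose N := (Num.truncn (M / fine (Q A))).+1.
  apply: le_trans (@nneseries_lim_ge _ (fun=> Q A) xpredT 0%N N _) => //.
  rewrite qE sumEFin lee_fin big_const_nat subn0 iter_addr_0.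
  rewrite -mulr_natl -ler_pdivrMr// ltW//.
  by have /andP[] := truncn_itv (divr_ge0 (ltW M0) (ltW q0)).
have := independent_infinitely_often hdist hindep (fun _ : nat => mA) Aoo.
by apply: filterS => w /(_ 0%N)[k _ kA]; exists k.
Qed.

Lemma properQ : ProperFilter (almost_everywhere Q).
Proof.
apply: ae_properfilter_algebraOfSetsType.
by rewrite [ltRHS](_ : _ = 1%E)//; exact: probability_setT.
Qed.

(** Every level below the essential supremum is exceeded with positive
    probability, hence almost surely by some term of the sequence. *)
Lemma ae_cvg_max : exists2 M : R, 0 < M &
  ess_sup Q (fun x : R => x%:E) = M%:E /\
  {ae Pr, forall w, \big[Num.max/p 0%N w]_(k < K) p k w @[K --> \oo] --> M}.
Proof.
have le1 : (ess_sup Q (fun x : R => x%:E) <= 1)%E.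
  by apply/ess_supP; move: aeQ; apply: filterS => x /andP[_ x1];
    rewrite lee_fin.
have gt0 : (0 < ess_sup Q (fun x : R => x%:E))%E.
  have := @filter_ex _ _ properQ _ (filterI aeQ (ess_sup_ge Q (fun x : R =>
    x%:E))).
  by move=> [x [/andP[x0 _]]]; apply: lt_le_trans; rewrite lte_fin.
pose M := fine (ess_sup Q (fun x : R => x%:E)).
have ME : ess_sup Q (fun x : R => x%:E) = M%:E.
  by rewrite fineK// gt0_fin_numE// (le_lt_trans le1)// ltry.
exists M; first by rewrite -lte_fin -ME.
split => //.
have leM : {ae Pr, forall w, forall k, p k w <= M}.
  apply: ae_foralln => k;
    apply: (ae_distribution hdist k (P := fun x => x <= M)).
  have := ess_sup_ge Q (fun x : R => x%:E); rewrite ME.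
  by apply: filterS => x; rewrite lee_fin.
have gtM : {ae Pr, forall w, forall n, exists k, M - n.+1%:R^-1 < p k w}.
  apply: ae_foralln => n.
  pose A := `]M - n.+1%:R^-1, +oo[%classic : set R.
  have mA : measurable A by exact: measurable_itv.
  have : (0 < Q A)%E.
    rewrite lt_neqAle measure_ge0 andbT; apply/negP => /eqP QA0.
    have : (ess_sup Q (fun x : R => x%:E) <= (M - n.+1%:R^-1)%:E)%E.
      apply/ess_supP; exists A; split => // x /= /negP.
      by rewrite lee_fin -ltNge /A/= in_itv/= andbT.
    by rewrite ME lee_fin leNgt gtrBl invr_gt0 ltr0n.
  move=> /(ae_exists_pvalue mA); apply: filterS => w [k].
  by rewrite /A/= in_itv/= andbT; exists k.
move: leM gtM; apply: filterS2 => w wM wk; apply/cvgrPdist_le => e e0.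
have [n ne] : exists n, n.+1%:R^-1 <= e.
  have /cvgrPdist_le/(_ e e0)[n _ Hn] := @cvg_harmonic R.
  exists n; have := Hn n (leqnn n); rewrite /= sub0r normrN.
  by rewrite ger0_norm// invr_ge0.
have [k kM] := wk n; near=> K.
have kK : (k < K)%N by near: K; exists k.+1.
have maxle : \big[Num.max/p 0%N w]_(k < K) p k w <= M.
  by apply/bigmax_leP; split.
rewrite ger0_norm ?subr_ge0// lerBlDr -lerBlDl.
rewrite (le_trans _ (le_bigmax _ _ (Ordinal kK)))//=.
by rewrite (le_trans _ (ltW kM))// lerB.
Unshelve. all: by end_near. Qed.

Lemma succ_root_gt0 (r : \bar R) : (- 1 < r)%E -> 0 < succ_root r.
Proof.
case: r => [s| |]//= s1; case: ifP => _; first exact: expR_gt0.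
by apply: powR_gt0; move: s1; rewrite lte_fin; lra.
Qed.

Lemma power_moment_fine_gt0 (r : R) : (- moment_index Q < r%:E)%E ->
  0 < fine (\int[Q]_x (x `^ r)%:E)%E /\
  (\int[Q]_x (x `^ r)%:E)%E = (fine (\int[Q]_x (x `^ r)%:E)%E)%:E.
Proof.
move=> Pr0; have gt0 := power_moment_gt0 aeQ r.
have lty := power_moment_lty aeQ Pr0.
by split; [rewrite fine_gt0// gt0 lty|rewrite fineK// gt0_fin_numE].
Qed.

Lemma moment_rootE (r : R) : r != 0 -> (- moment_index Q < r%:E)%E ->
  moment_root Q r%:E = ((fine (\int[Q]_x (x `^ r)%:E)%E) `^ r^-1)%:E.
Proof.
move=> r0 /power_moment_fine_gt0[m0 mE].
by rewrite /moment_root (negbTE r0) integral_epowE// mE epow_powR.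
Qed.

Lemma ae_cvg_power_mean (r : R) : r != 0 -> (- moment_index Q < r%:E)%E ->
  {ae Pr, forall w, power_mean r%:E K (fun k => p k w) @[K --> \oo] -->
    fine (moment_root Q r%:E)}.
Proof.
move=> r0 rPi; rewrite moment_rootE//=.
have [m0 mE] := power_moment_fine_gt0 rPi.
have := ae_mean_power hdist hindep aeQ rPi.
have := ae_pvalues hdist aeQ; apply: filterS2 => w wp wl.
have := cvg_powR_const (s := r^-1) m0 wl; apply: cvg_trans; apply: near_eq_cvg.
near=> K; apply/esym; apply: (@power_meanE R r K (fun k => p k w) r0).
  by move=> k; have /andP[] := wp k.
by near: K; exists 1%N.
Unshelve. all: by end_near. Qed.

(** The cases r = 0 and r = +oo differ from the others only through the result
    that gives the limit of the mean. *)
Lemma ae_cvg_merged (r : \bar R) : (- 1 < r)%E -> (- moment_index Q < r)%E ->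
  let L := ((succ_root r)%:E * moment_root Q r)%E in
  (0 < L < +oo)%E /\ {ae Pr, forall w, (P r K w)%:E @[K --> \oo] --> L}.
Proof.
move=> r1 rPi; have c0 := succ_root_gt0 r1.
suff [l l0 [lE wl]] : exists2 l : R, 0 < l & moment_root Q r = l%:E /\
    {ae Pr, forall w, power_mean r K (fun k => p k w) @[K --> \oo] --> l}.
  rewrite lE /= -EFinM lte_fin mulr_gt0// ltry; split => //.
  move: wl; apply: filterS => w wl; apply: cvg_EFin; first exact: nearW.
  suff H : P r K w @[K --> \oo] --> succ_root r * l by exact: H.
  have -> : (fun K => P r K w) =
      (fun K => succ_root r * power_mean r K (fun k => p k w)).
    apply/funext => K; rewrite /P /merged; congr (_ * _).
    by case: r r1 {rPi c0 lE wl} => [s| |]//;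
      rewrite -EFinN lte_fin /avg_coef => ->.
  by apply: cvgM => //; exact: cvg_cst.
case: r r1 rPi {c0} => [r| |]// r1 rPi; last first.
  by have [M M0 [ME wM]] := ae_cvg_max; exists M.
have [r0|r0] := eqVneq r 0.
  rewrite r0; have [l [lE wl]] := ae_mean_ln hdist hindep aeQ Pi0.
  exists (expR l); first exact: expR_gt0.
  split; first by rewrite /moment_root eqxx lE.
  move: (ae_pvalues hdist aeQ) wl; apply: filterS2 => w wp wl.
  have := cvg_comp _ _ wl (@continuous_expR R l).
  apply: cvg_trans; apply: near_eq_cvg; apply: nearW => K; apply/esym;
    apply: (@power_mean0E R K (fun k => p k w)) => k.
  by have /andP[] := wp k.
exists (fine (moment_root Q r%:E)).
  by rewrite moment_rootE//= powR_gt0//; have [] := power_moment_fine_gt0 rPi.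
split; first by rewrite moment_rootE.
exact: ae_cvg_power_mean.
Qed.

Lemma ae_merged_equiv (r : R) : (- moment_index Q < r%:E)%E -> r < -1 ->
  let c K := r / (r + 1) * K%:R `^ (1 + r^-1) * fine (moment_root Q r%:E) in
  [/\ {ae Pr, forall w, P r%:E K w / c K @[K --> \oo] --> (1 : R)},
      c K @[K --> \oo] --> +oo &
      {ae Pr, forall w, P r%:E K w @[K --> \oo] --> +oo}].
Proof.
move=> rPi r1 c.
have r0 : r < 0 by lra.
have rn0 : r != 0 by rewrite lt_eqF.
have l0 : 0 < fine (moment_root Q r%:E).
  by rewrite moment_rootE//= powR_gt0//; have [] := power_moment_fine_gt0 rPi.
have k0 : 0 < r / (r + 1) by rewrite nmulr_rgt0// invr_lt0; lra.
have cE K : c K = avg_coef r%:E K * fine (moment_root Q r%:E).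
  by rewrite /c /avg_coef ltNge (ltW r1)/= (lt_eqF r1).
have cpos K : (0 < K)%N -> 0 < c K.
  by move=> K0; rewrite pmulr_lgt0// pmulr_rgt0// powR_gt0// ltr0n.
have coo : c K @[K --> \oo] --> +oo.
  have e0 : 0 < 1 + r^-1.
    have -> : 1 + r^-1 = (r + 1) / r by field.
    by rewrite nmulr_rgt0 ?invr_lt0//; lra.
  apply/cvgryPge => A; near=> K.
  rewrite /c mulrAC -ler_pdivrMl ?(mulr_gt0 k0 l0)//.
  near: K; move/cvgryPge: (cvg_natr_powR_pinfty e0); exact.
have ratio : {ae Pr, forall w, P r%:E K w / c K @[K --> \oo] --> (1 : R)}.
  have := ae_cvg_power_mean rn0 rPi; apply: filterS => w wl.
  have : power_mean r%:E K (fun k => p k w) / fine (moment_root Q r%:E) @[K -->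
    \oo] --> (1 : R).
    by rewrite -(divff (lt0r_neq0 l0)); apply: cvgM => //; exact: cvg_cst.
  apply: cvg_trans; apply: near_eq_cvg; near=> K; cbv beta.
  have K0 : (0 < K)%N by near: K; exists 1%N.
  have a0 : avg_coef r%:E K != 0.
    by have := cpos K K0; rewrite cE => /lt0r_neq0;
      rewrite mulf_eq0 negb_or => /andP[].
  have -> : c K = avg_coef r%:E K * fine (moment_root Q r%:E) by exact: cE.
  rewrite /P /merged; move: (power_mean _ _ _) (fine _) l0 => x y y0.
  by field; rewrite a0 gt_eqF.
split => //; move: ratio; apply: filterS => w wl.
apply/cvgryPge => A; near=> K.
have K0 : (0 < K)%N by near: K; exists 1%N.
have h : 2^-1 <= P r%:E K w / c K.
  near: K; apply: (cvgr_ge _ wl); lra.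
have cA : 2 * `|A| <= c K by near: K; move/cvgryPge: coo; exact.
move: h; rewrite ler_pdivlMr ?cpos//; have := ler_norm A; lra.
Unshelve. all: by end_near. Qed.

End limits.

(** * The divergent moments *)

Section rates.
Context {d : measure_display} {T : measurableType d} {R : realType}.
Context {Pr : probability T R} {Q : probability R R}.
Context {p : nat -> {RV Pr >-> R}}.
Hypothesis hdist : forall (k : nat) (A : set R),
  measurable A -> distribution Pr (p k) A = Q A.
Hypothesis hindep : mutually_independent p.
Hypothesis aeQ : {ae Q, forall x : R, 0 < x <= 1}.
Hypothesis Pi0 : (0 < moment_index Q)%E.

Let invPi := fine (moment_index Q)^-1%E.
Let P (r : \bar R) (K : nat) (w : T) : R := merged r K (fun k => p k w).

Lemma invPi_ge0 : 0 <= invPi.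
Proof. by rewrite fine_ge0// inve_ge0 ltW. Qed.

Lemma invPi_gt0 : (moment_index Q < +oo)%E -> 0 < invPi.
Proof.
move: Pi0; rewrite /invPi; case: (moment_index Q) => [y| |]//.
by rewrite lte_fin => y0 _; rewrite inver gt_eqF//= invr_gt0.
Qed.

Lemma inv_lt_invPi (s : R) : (moment_index Q < s%:E)%E -> s^-1 < invPi.
Proof.
move: Pi0; rewrite /invPi; case: (moment_index Q) => [y| |]//.
rewrite !lte_fin => y0 ys; rewrite inver gt_eqF//= ltf_pV2 ?posrE//.
exact: lt_trans ys.
Qed.

Lemma exists_harmonic_lt (e : R) : 0 < e -> exists n : nat, n.+1%:R^-1 < e.
Proof.
move=> e0; have /cvgrPdist_lt/(_ e e0)[n _ Hn] := @cvg_harmonic R.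
exists n; have := Hn n (leqnn n); rewrite /= sub0r normrN.
by rewrite ger0_norm// invr_ge0.
Qed.

(** The orders t = 1/Pi + 1/(n+1) and t = (1/Pi) (1 - 1/(n+2)) approach 1/Pi
    from both sides. Countably many of them suffice, which makes a single null
    set serve all exponents b. *)
Lemma approx_pow_power_sum (r c g : R) : r < 0 -> (r%:E < - moment_index Q)%E ->
  0 < c ->
  (forall K w, (0 < K)%N -> (forall k, 0 < p k w) ->
    P r%:E K w = c * (K%:R `^ g * (\sum_(k < K) p k w `^ r) `^ r^-1)) ->
  approx_pow Pr (P r%:E) (g - invPi).
Proof.
move=> r0 rPi c0 PE.
have rPi' : (moment_index Q < (- r)%:E)%E by rewrite EFinN lteNr.
have invPi0 : 0 < invPi by apply: invPi_gt0; rewrite (lt_trans rPi')// ltry.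
have sPi : (- r)^-1 < invPi by exact: inv_lt_invPi.
have lower : {ae Pr, forall w, forall n, exists2 C : R, 0 < C &
    \forall K \near \oo, C * K%:R `^ (- (invPi + n.+1%:R^-1)) <=
      (\sum_(k < K) p k w `^ r) `^ r^-1}.
  apply: ae_foralln => n; set t := invPi + _.
  have tPi : invPi < t by rewrite ltrDl invr_gt0 ltr0n.
  have t0 : 0 < t := lt_trans invPi0 tPi.
  have [C C0 wC] := ae_power_sum_bound hdist hindep aeQ Pi0 tPi.
  move: (ae_pvalues hdist aeQ) wC; apply: filterS2 => w wp wC.
  exists C; first exact: C0.
  near=> K; have K0 : (0 < K)%N by near: K; exists 1%N.
  have st : 0 < t^-1 <= - r.
    rewrite invr_gt0 t0/= -[leRHS]invrK lef_pV2 ?posrE ?invr_gt0 ?oppr_gt0//.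
    by rewrite ltW// (lt_trans sPi).
  have := power_sum_root_homo st (fun k => proj1 (andP (wp k))) K0.
  rewrite invrK opprK invrN opprK; apply: le_trans.
  by near: K.
have upper : {ae Pr, forall w, forall n : nat, forall m, exists2 k, (m <= k)%N &
    p k w <= k.+1%:R `^ (- (invPi * (1 - n.+2%:R^-1)))}.
  apply: ae_foralln => n.
  apply: (ae_small_pvalues hdist hindep aeQ Pi0).
    by rewrite mulr_gt0// subr_gt0 invf_lt1 ?ltr0n// ltr1n.
  by rewrite gtr_pMr// gtrBl invr_gt0 ltr0n.
rewrite /approx_pow.
apply: filterS (filterI (ae_pvalues hdist aeQ) (filterI lower upper)).
move=> w [wp [wlo wup]].
have wp0 k : 0 < p k w by have /andP[] := wp k.
pose v K := (\sum_(k < K) p k w `^ r) `^ r^-1.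
split => b hb.
- have : 0 < (b - (g - invPi)) / invPi by rewrite divr_gt0// subr_gt0.
  move=> /exists_harmonic_lt[n]; rewrite ltr_pdivlMr// => nb.
  have n2 : n.+2%:R^-1 <= n.+1%:R^-1 :> R.
    by rewrite lef_pV2 ?posrE ?ltr0n// ler_nat.
  apply: (@rate_limn_einf0 R _ v c g (invPi * (1 - n.+2%:R^-1))) => //.
  + rewrite mulrBr mulr1; have := ler_wpM2l (ltW invPi0) n2.
    by move: nb; rewrite mulrC; move: (invPi * _) (invPi * _) => y z; lra.
  + by move=> K; exact: powR_ge0.
  + by move=> K K0; exact: PE.
  + move=> m; have [k mk pk] := wup n m; exists k => //.
    apply: le_trans pk.
    have := @power_sum_root_le R (fun k => p k w) (- r) k.+1 k.
    by rewrite oppr_gt0 opprK invrN opprK; apply.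
- have : 0 < g - invPi - b by rewrite subr_gt0.
  move=> /exists_harmonic_lt[n nb]; have [C C0 wC] := wlo n.
  apply: (@rate_pinfty R _ v c C g (invPi + n.+1%:R^-1)) => //.
    by move: nb; move: n.+1%:R^-1 => z; lra.
  by exists 1%N => // K /= K0; exact: PE.
Unshelve. all: by end_near. Qed.

Lemma approx_pow_gtN1 (r : R) : -1 < r -> r < 0 ->
  (r%:E < - moment_index Q)%E -> approx_pow Pr (P r%:E) (- r^-1 - invPi).
Proof.
move=> r1 r0 rPi; apply: (@approx_pow_power_sum r ((r + 1) `^ r^-1)) => //.
  by apply: powR_gt0; lra.
by move=> K w K0 wp; exact: merged_gtN1E.
Qed.

Lemma approx_pow_ltN1 (r : R) : r < -1 ->
  (r%:E < - moment_index Q)%E -> approx_pow Pr (P r%:E) (1 - invPi).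
Proof.
move=> r1 rPi; have r0 : r < 0 by lra.
apply: (@approx_pow_power_sum r (r / (r + 1))) => //.
  by rewrite nmulr_rgt0// invr_lt0; lra.
by move=> K w K0 wp; exact: merged_ltN1E.
Qed.

Lemma mergedNyE K w :
  P -oo%E K w = 1 * (K%:R `^ 1 * \big[Num.min/p 0%N w]_(k < K) p k w).
Proof. by rewrite mul1r powRr1. Qed.

Lemma measurable_bigmin K :
  measurable_fun setT (fun w => \big[Num.min/p 0%N w]_(k < K) p k w).
Proof.
have H (s : seq nat) :
    measurable_fun setT (fun w => \big[Num.min/p 0%N w]_(k <- s) p k w).
  elim: s => [|k s IH].
    rewrite [X in measurable_fun _ X](_ : _ = (p 0%N : T -> R))//.
    by apply/funext => w; rewrite big_nil.
  rewrite [X in measurable_fun _ X](_ : _ = (fun w => Num.min (p k w)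
      (\big[Num.min/p 0%N w]_(k <- s) p k w))).
    exact: measurable_minr.
  by apply/funext => w; rewrite big_cons.
rewrite [X in measurable_fun _ X](_ : _ =
    (fun w => \big[Num.min/p 0%N w]_(k <- index_iota 0 K) p k w))//.
by apply/funext => w; rewrite big_mkord.
Qed.

(** The divergence even holds almost surely, by the lower bound of the minimum
    through a power sum of order - 1/t with 1/Pi < t < 1 - b. *)
Lemma mergedNy_pinfty_in_probability (b : R) : b < 1 - invPi ->
  cvg_infty_in_probability Pr (fun K w => P -oo%E K w / K%:R `^ b).
Proof.
move=> hb; apply: ae_pinfty_in_probability.
  move=> K; apply: measurable_funM => //.
  by apply: measurable_funM => //; exact: measurable_bigmin.
pose t := (invPi + (1 - b)) / 2.
have tPi : invPi < t by rewrite /t; lra.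
have t0 : 0 < t := le_lt_trans invPi_ge0 tPi.
have [C C0 wC] := ae_power_sum_bound hdist hindep aeQ Pi0 tPi.
move: (ae_pvalues hdist aeQ) wC; apply: filterS2 => w wp wC.
apply: (@rate_pinfty R _ (fun K => \big[Num.min/p 0%N w]_(k < K) p k w) 1 C 1
  t) => //.
- by rewrite /t; lra.
- by apply: nearW => K; exact: mergedNyE.
- near=> K; have K0 : (0 < K)%N by near: K; exists 1%N.
  have le k : (k < K)%N -> C * K%:R `^ (- t) <= p k w.
    move=> kK; apply: (@le_trans _ _ ((\sum_(k < K) p k w `^ (- t^-1)) `^ (-
      t))).
      by near: K.
    have := @power_sum_root_le R (fun k => p k w) t^-1 K k.
    by rewrite invr_gt0 invrK; apply => //; have /andP[] := wp k.
  by apply/bigmin_geP; split => [|k _]; exact: le.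
Unshelve. all: by end_near. Qed.

(** The order t must lie below 1/Pi, above 1 - b, and be positive, hence the
    midpoint between 1/Pi and the larger of 0 and 1 - b. *)
Lemma mergedNy_limn_einf0 (b : R) : (moment_index Q < +oo)%E ->
  1 - invPi < b ->
  {ae Pr, forall w, limn_einf (fun K => (P -oo%E K w / K%:R `^ b)%:E) = 0%E}.
Proof.
move=> /invPi_gt0 invPi0 hb.
pose t := (invPi + Num.max 0 (1 - b)) / 2.
have [m0 [m1 m2]] : 0 <= Num.max 0 (1 - b) /\
    (1 - b <= Num.max 0 (1 - b) /\ Num.max 0 (1 - b) < invPi).
  by rewrite !le_max lexx gt_max invPi0 lexx orbT; split => //; split => //=;
    lra.
have t0 : 0 < t by rewrite /t; lra.
have tPi : t < invPi by rewrite /t; lra.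
have := ae_small_pvalues hdist hindep aeQ Pi0 t0 tPi.
have := ae_pvalues hdist aeQ; apply: filterS2 => w wp wk.
apply: (@rate_limn_einf0 R _ (fun K => \big[Num.min/p 0%N w]_(k < K) p k w) 1 1
  t) => //.
- by rewrite /t; lra.
- move=> K; apply/bigmin_geP.
  by split => [|k _]; [have /andP[/ltW] := wp 0%N|have /andP[/ltW] := wp k].
- by move=> K _; exact: mergedNyE.
- move=> n; have [k nk pk] := wk n; exists k => //.
  apply: le_trans pk.
  exact: (bigmin_le _ (Ordinal (ltnSn k)) (fun i : 'I_k.+1 => p i w)).
Qed.

End rates.

(** * The asymptotic regimes *)

Theorem proposition11 (d : measure_display) (T : measurableType d)
    (R : realType) (Pr : probability T R) (Q : probability R R)
    (p : nat -> {RV Pr >-> R}) (hQ : Q `[0, 1]%classic = 1%E)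
    (hdist : forall (k : nat) (A : set R),
      measurable A -> distribution Pr (p k) A = Q A)
    (hindep : mutually_independent p) :
  let Pi := moment_index Q in
  let invPi := fine (Pi^-1)%E in
  let P (r : \bar R) (K : nat) (w : T) : R := merged r K (fun k => p k w) in
  ((1 < Pi)%E ->
    [/\ forall r : \bar R, (- 1 < r)%E ->
          let L := ((succ_root r)%:E * moment_root Q r)%E in
          (0 < L < +oo)%E /\
          {ae Pr, forall w, (P r K w)%:E @[K --> \oo] --> L},
        forall r : R, (- Pi < r%:E)%E -> r < -1 ->
          let c (K : nat) : R :=
            r / (r + 1) * K%:R `^ (1 + r^-1) * fine (moment_root Q r%:E) in
          [/\ {ae Pr, forall w, P r%:E K w / c K @[K --> \oo] --> (1 : R)},
              c K @[K --> \oo] --> +oo &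
              {ae Pr, forall w, P r%:E K w @[K --> \oo] --> +oo}],
        forall r : R, (r%:E < - Pi)%E ->
          approx_pow Pr (P r%:E) (1 - invPi) /\
          (K%:R `^ (1 - invPi) : R) @[K --> \oo] --> +oo &
        forall b : R, b < 1 - invPi ->
          cvg_infty_in_probability Pr
            (fun K w => P -oo%E K w / K%:R `^ b)])
  /\
  ((0 < Pi < 1)%E ->
    [/\ forall r : \bar R, (- Pi < r)%E ->
          let L := ((succ_root r)%:E * moment_root Q r)%E in
          (0 < L < +oo)%E /\
          {ae Pr, forall w, (P r K w)%:E @[K --> \oo] --> L},
        forall r : R, -1 < r -> (r%:E < - Pi)%E ->
          approx_pow Pr (P r%:E) (- r^-1 - invPi) /\
          (K%:R `^ (- r^-1 - invPi) : R) @[K --> \oo] --> (0 : R),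
        forall r : R, r < -1 ->
          approx_pow Pr (P r%:E) (1 - invPi) /\
          (K%:R `^ (1 - invPi) : R) @[K --> \oo] --> (0 : R) &
        forall b : R, 1 - invPi < b ->
          {ae Pr, forall w,
            limn_einf (fun K => (P -oo%E K w / K%:R `^ b)%:E) = 0%E}]).
Proof.
move=> Pi invPi P; split => [Pi1|/andP[Pi0 Pi1]].
- have Pi0 : (0 < Pi)%E := lt_trans lte01 Pi1.
  have aeQ := ae_pvalue hQ Pi0.
  have NPi1 : (- Pi < - 1)%E by rewrite lteN2.
  have invPi1 : invPi < 1.
    rewrite /invPi; case: (Pi) Pi0 Pi1 => [y| |]//; rewrite !lte_fin => y0 y1.
    by rewrite inver gt_eqF//= invf_lt1.
  split.
  + move=> r r1; apply: (ae_cvg_merged hdist hindep aeQ Pi0 r1).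
    exact: lt_trans NPi1 r1.
  + by move=> r rPi r1; exact: (ae_merged_equiv hdist hindep aeQ).
  + move=> r rPi; split.
      apply: (approx_pow_ltN1 hdist hindep aeQ Pi0) => //.
      by rewrite -lte_fin EFinN (lt_trans rPi).
    by apply: cvg_natr_powR_pinfty; rewrite subr_gt0.
  + by move=> b; exact: (mergedNy_pinfty_in_probability hdist hindep aeQ Pi0).
- have aeQ := ae_pvalue hQ Pi0.
  have Piy : (Pi < +oo)%E := lt_trans Pi1 (ltry 1).
  have NPi1 : (- 1 < - Pi)%E by rewrite lteN2.
  have invPi1 : 1 < invPi.
    have := @inv_lt_invPi _ Q Pi0 1; rewrite invr1; exact.
  split.
  + move=> r rPi; apply: (ae_cvg_merged hdist hindep aeQ Pi0) => //.
    exact: lt_trans NPi1 rPi.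
  + move=> r r1 rPi; have r0 : r < 0.
      by rewrite -lte_fin (lt_trans rPi)// oppe_lt0.
    split; first exact: (approx_pow_gtN1 hdist hindep aeQ Pi0).
    apply: cvg_natr_powR_0; rewrite subr_lt0 -invrN.
    by apply: (inv_lt_invPi Pi0); rewrite EFinN lteNr.
  + move=> r r1; split.
      apply: (approx_pow_ltN1 hdist hindep aeQ Pi0) => //.
      by apply: lt_trans NPi1; rewrite lte_fin.
    by apply: cvg_natr_powR_0; rewrite subr_lt0.
  + by move=> b; exact: (mergedNy_limn_einf0 hdist hindep aeQ Pi0).
Qed.
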